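(* Let $k\ge1$ and let $\beta=\alpha_{n_1\dots n_k}$ ($0\le n_i\le 3$, $n_k\neq0$) be a periodic direction, and let $\dots,\gamma_{-2},\gamma_{-1},\gamma_0,\gamma_1,\gamma_2,\dots$ be all the points connected with $\beta$ by a side of an ideal pentagon of some generation, ordered as follows: $\gamma_{-1}$ and $\gamma_0$ are the two neighbours of $\beta$ in the pentagon of generation $k$ having $\beta$ as a vertex; $\gamma_0,\gamma_1,\gamma_2,\dots$ are the points lying on the same side of $\beta$ as $\gamma_0$, in order of approach to $\beta$; and $\gamma_{-1},\gamma_{-2},\dots$ are the points lying on the other side of $\beta$, in order of approach to $\beta$. Let $(b,B)$, $b\le B$, be the pair of periods corresponding to $\beta$, and let $(c_i,C_i)$ be the pair of periods (smaller one first) corresponding to $\gamma_i$, multiplied by $-1$ if $i<0$. Then $$\dots,(c_{-2},C_{-2}),(c_{-1},C_{-1}),(c_0,C_0),(c_1,C_1),(c_2,C_2),\dots$$ is an arithmetic sequence with the difference $(B,b+B)$.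
   Context: Let $\phi=\frac{1+\sqrt5}{2}$. Let $P$ be a regular plane pentagon of side $1$ with a horizontal side at the bottom; label its sides, counterclockwise starting from the bottom side, by $3,5,2,4,1$. Let $P'=-P$ be its centrally symmetric copy; the side of $P'$ parallel to side $i$ of $P$ is also labelled $i$. The double pentagon $X$ is the flat surface obtained from $P\sqcup P'$ by gluing, for each $i$, the two sides labelled $i$ by a parallel translation. Directions of linear trajectories on $X$ are considered modulo $180^\circ$. The direction making angle $\theta$ (counterclockwise) with the horizontal is identified with the point $x=-\sin 36^\circ\cot\theta\in\mathbb{R}\cup\{\infty\}$. The 3rd sector is $72^\circ\le\theta\le108^\circ$, i.e. $\frac{\phi}{2}-1\le x\le 1-\frac{\phi}{2}$. Regard $\mathbb{R}\cup\{\infty\}$ as the boundary at infinity of the hyperbolic plane. The ideal pentagon of generation $0$ has vertices $1-\frac{\phi}{2},\frac{\phi}{2},\infty,-\frac{\phi}{2},\frac{\phi}{2}-1$ (in cyclic order). The pentagons of generation $k+1$ are obtained from those of generation $k$ by reflecting each of them in its sides (for $k\ge1$, in its four sides not shared with a pentagon of generation $k-1$). The vertices in the 3rd sector are labelled recursively: put $\alpha=1-\frac{\phi}{2}$ and let $I_\emptyset$ be the arc from $\alpha$ down to $\frac{\phi}{2}-1$. Given an arc $I_{n_1\dots n_k}$ whose endpoints span a side of a pentagon of generation $k$, the pentagon of generation $k+1$ across this side has vertices $v_0>v_1>v_2>v_3>v_4$ with $v_0,v_4$ the endpoints of the arc; set $\alpha_{n_1\dots n_k m}=v_m$ and let $I_{n_1\dots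 n_k m}$ be the arc from $v_m$ to $v_{m+1}$, $0\le m\le3$ (so $\alpha_{n_1\dots n_k0}=\alpha_{n_1\dots n_k}$, and trailing zeros are dropped). All vertices of these pentagons are periodic directions: for such a direction $X$ decomposes into two strips of parallel closed trajectories. The symbolic orbit of a closed trajectory is the cyclic word in $1,\dots,5$ formed by the labels of the sides consecutively crossed in one traversal; it is the same for all trajectories of one strip. The (Arabic) period is the length of this word; for directions in the 3rd sector the Roman period is half of the Arabic one. The pair of periods of a direction consists of the periods of its two strips; either Roman periods are used throughout or Arabic periods are used throughout. *)

(* Defs.v *)
From mathcomp Require Import all_boot all_order all_algebra.
From mathcomp Require Import all_classical all_reals all_analysis.
From Stdlib Require Import Relation_Operators.

Set Implicit Arguments.
Unset Strict Implicit.
Unset Printing Implicit Defensive.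

Import Order.TTheory GRing.Theory Num.Theory.
Local Open Scope classical_set_scope.
Local Open Scope ring_scope.

Definition phi {R : realType} : R := (1 + Num.sqrt 5) / 2.

(* Sides of P are indexed by 'I_5 counterclockwise, 0 being the bottom side;
   this is the label of each of them. *)
Definition side_label (j : 'I_5) : nat := nth 0%N [:: 3; 5; 2; 4; 1]%N j.

Definition side_vector {R : realType} (j : nat) : R * R :=
  (cos (2 * pi * j%:R / 5), sin (2 * pi * j%:R / 5)).

(* Vertex j of P, the start of side j; vertex 0 is put at the origin. *)
Definition corner {R : realType} (j : nat) : R * R :=
  \sum_(i < j) side_vector i.

(* (j, t) stands for the point at distance t from the start of side j of P.
   It is glued by a translation to a point of the parallel side of P' = - P;
   as the central symmetry reverses the side, that point is the opposite of the
   point (j, 1 - t) of P.  Hence a pair (j, t) with 0 < t < 1 is a point of X on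
   the j-th (glued) open side, and [position copy (j, t)] is its representative
   in P (copy = false) or in P' (copy = true). *)
Definition position {R : realType} (copy : bool) (c : 'I_5 * R) : R * R :=
  if copy then - (corner c.1 + (1 - c.2) *: side_vector c.1)
  else corner c.1 + c.2 *: side_vector c.1.

Definition on_open_side {R : realType} (c : 'I_5 * R) : Prop := 0 < c.2 < 1.

(* The trajectory in direction theta leaving from c next crosses a side at c'.
   By convexity, a segment joining inner points of two different sides of P (or
   P') runs inside the pentagon, which is therefore the one entered at c. *)
Definition next_crossing {R : realType} (theta : R) (c c' : 'I_5 * R) : Prop :=
  [/\ on_open_side c, on_open_side c', c.1 != c'.1 &
      exists copy : bool, exists2 l : R, 0 < l &
        position copy c' - position copy c = l *: (cos theta, sin theta)].

(* A closed trajectory is given by its successive crossings in one traversal: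
   the flow in a fixed direction is deterministic, so that a traversal is run
   once exactly when its crossings are pairwise distinct. *)
Definition closed_trajectory {R : realType} (theta : R) (s : seq ('I_5 * R)) :
    Prop :=
  s <> [::] /\ ucycle (fun c c' => `[< next_crossing theta c c' >]) s.

(* To be read up to rotation. *)
Definition symbolic_orbit {R : realType} (s : seq ('I_5 * R)) : seq nat :=
  [seq side_label c.1 | c <- s].

Definition periodic {R : realType} (theta : R) (c : 'I_5 * R) : Prop :=
  exists2 s, closed_trajectory theta s & c \in s.

(* Either c' follows c on a trajectory, or c and c' lie on the same side and all
   points between them are on closed trajectories. *)
Definition strip_move {R : realType} (theta : R) (c c' : 'I_5 * R) : Prop :=
  next_crossing theta c c' \/
  (c.1 = c'.1 /\
   forall t : R, Num.min c.2 c'.2 <= t <= Num.max c.2 c'.2 ->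
     periodic theta (c.1, t)).

(* A strip is a connected component of the union of the closed trajectories of
   a given direction; it is represented by the set of its points on the sides. *)
Definition strip {R : realType} (theta : R) (S : set ('I_5 * R)) : Prop :=
  exists2 c, periodic theta c &
    S = [set c' | clos_refl_sym_trans _ (strip_move theta) c c'].

(* The Roman period is the half of the Arabic one only for directions in the
   3rd sector (72 to 108 degrees), which are the only ones where [Roman] is meant to be used. *)
Inductive period_kind := Arabic | Roman.

Definition arabic_length (kind : period_kind) (p : nat) : nat :=
  if kind is Arabic then p else p.*2.

Definition strip_period {R : realType} (kind : period_kind) (theta : R)
    (S : set ('I_5 * R)) (p : nat) : Prop :=
  exists s, [/\ closed_trajectory theta s, forall c, c \in s -> S c &
                size (symbolic_orbit s) = arabic_length kind p].

(* [option R] is the boundary at infinity, None being the point oo. *)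
Definition direction_point {R : realType} (theta : R) : option R :=
  if sin theta == 0 then None
  else Some (- sin (pi / 5) * (cos theta / sin theta)).

Definition period_pair {R : realType} (kind : period_kind) (x : R)
    (b B : nat) : Prop :=
  (b <= B)%N /\
  exists2 theta : R, direction_point theta = Some x &
  exists S1 S2 : set ('I_5 * R),
    [/\ S1 <> S2, forall S, strip theta S <-> S = S1 \/ S = S2,
        strip_period kind theta S1 b & strip_period kind theta S2 B].

(* Action on the boundary of the reflection in the geodesic with endpoints a
   and b: the inversion in the circle of diameter [a, b], or, when an endpoint
   is oo, the symmetry about the other one. *)
Definition reflection {R : realType} (a b x : option R) : option R :=
  match a, b, x with
  | Some a, Some b, Some x =>
      if x == (a + b) / 2 then None
      else Some ((a + b) / 2 + ((b - a) / 2) ^+ 2 / (x - (a + b) / 2))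
  | Some a, Some b, None => Some ((a + b) / 2)
  | Some a, None, Some x | None, Some a, Some x => Some (2 * a - x)
  | _, _, None => None
  | None, None, Some x => Some x
  end.

(* An ideal pentagon is the cyclic sequence of its vertices. *)
Definition is_side {R : realType} (p : 5.-tuple (option R)) (x y : option R) :
    Prop :=
  exists j : 'I_5, (x = tnth p j /\ y = tnth p (ordS j)) \/
                   (y = tnth p j /\ x = tnth p (ordS j)).

Definition pentagon0 {R : realType} : 5.-tuple (option R) :=
  [tuple Some (1 - phi / 2); Some (phi / 2); None;
         Some (- (phi / 2)); Some (phi / 2 - 1)].

Fixpoint generation {R : realType} (k : nat) (q : 5.-tuple (option R)) : Prop :=
  match k with
  | 0%N => q = pentagon0
  | k1.+1 => exists p x y,
      [/\ generation k1 p, is_side p x y,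
          q = map_tuple (reflection x y) p &
          match k1 with
          | 0%N => True
          | k2.+1 => forall r, generation k2 r -> ~ is_side r x y
          end]
  end.

(* [sector_arc w a b]: the arc I_w goes from a down to b. *)
Inductive sector_arc {R : realType} : seq 'I_4 -> R -> R -> Prop :=
| sector_arc0 : sector_arc [::] (1 - phi / 2) (phi / 2 - 1)
| sector_arcS (w : seq 'I_4) (a b : R) (p : 5.-tuple (option R))
    (v : 5.-tuple R) (m : 'I_4) :
    sector_arc w a b ->
    generation (size w).+1 p ->
    perm_eq p [seq Some x | x <- v] -> sorted >%R v -> v`_0 = a -> v`_4 = b ->
    sector_arc (rcons w m) v`_m v`_m.+1.

(* alpha_w is the upper end of I_w. *)
Definition is_alpha {R : realType} (w : seq 'I_4) (x : R) : Prop :=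
  exists b, sector_arc w x b.

Definition adjacent {R : realType} (x y : option R) : Prop :=
  exists k p, generation k p /\ is_side p x y.

Definition neighbour_sequence {R : realType} (k : nat) (beta : R)
    (gamma : int -> R) : Prop :=
  [/\ forall y, adjacent (Some beta) y <-> exists i, y = Some (gamma i),
      exists p (j : 'I_5), [/\ generation k p, tnth p j = Some beta &
        (Some (gamma (-1)) = tnth p (ord_pred j) /\
         Some (gamma 0) = tnth p (ordS j)) \/
        (Some (gamma (-1)) = tnth p (ordS j) /\
         Some (gamma 0) = tnth p (ord_pred j))],
      forall i, 0 <= i -> 0 < (gamma i - beta) * (gamma 0 - beta) /\
        `|gamma (i + 1) - beta| < `|gamma i - beta| &
      forall i, i < 0 -> (gamma i - beta) * (gamma 0 - beta) < 0 /\
        `|gamma (i - 1) - beta| < `|gamma i - beta|].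

Definition arithmetic_sequence (V : zmodType) (s : int -> V) (d : V) : Prop :=
  forall i, s (i + 1) - s i = d.

(* Main.v *)
Require Import Defs.
From mathcomp Require Import all_boot all_order all_algebra.
From mathcomp Require Import all_classical all_reals all_analysis.
From mathcomp Require Import ring lra zify.
From Stdlib Require Import Relation_Operators.

Import Order.TTheory GRing.Theory Num.Theory.
Local Open Scope ring_scope.
Set Implicit Arguments.
Unset Strict Implicit.
Unset Printing Implicit Defensive.

(** Every vertex x of the tessellation has a short vector s(x) in Z[phi]^2,
    parallel to the direction x, such that the closed trajectories of the two
    strips in this direction have holonomy s(x) and phi s(x).  In the third
    sector a trajectory crosses each side always in the same sense, so that the
    number of sides crossed is a linear form in the holonomy.  Thus b, B and
    b + B are the values of one linear form at s(beta), phi s(beta) and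
    phi^2 s(beta) = s(beta) + phi s(beta).  In the tessellation, the points
    adjacent to beta have the short vectors s(gamma_0) + i phi s(beta) for
    i >= 0 on one side of beta, and s(gamma_(-1)) + i phi s(beta) on the other
    one, where s(gamma_0) + s(gamma_(-1)) = phi s(beta).  Applying the linear
    form to these vectors and to their multiples by phi gives the arithmetic
    sequence ([arithmetic_periods]).

    Coordinates are chosen so that the directions of the third sector are the
    rays of the quadrant x, y >= 0, the ends of the sector being u = (1, 0) and
    v = (0, 1).  Four matrices [sector_map] of determinant 1 take the quadrant
    to the four cones into which it is cut by (phi, 1), (phi, phi) and (1, phi);
    the arc I_w is the cone spanned by the images of u and v under the product
    of the matrices of w, and s(alpha_w) is the image of u
    ([sector_arc_word]).

    Holonomies.  For a direction d in the quadrant, the first return map of the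
    flow to the sides leading from P to P' is an exchange F_d of four intervals
    ([crosses_twice], [crosses_step]).  The point of the proof is a
    renormalization: F_d is the map induced by F_(sigma d) on an interval, for
    each of the four matrices sigma ([itinerary_piece], [itinerary_cover]).
    This is the combinatorial trace of the affine symmetries of X.  For d = u and
    d = v the map F_d is the identity and has two obvious towers, with
    holonomies s and phi s, and renormalization transports towers along words
    ([two_towers_word]).  A closed trajectory is a periodic orbit of F_d, hence
    runs through one of the towers, and exactly once because s is not a proper
    multiple in Z[phi]^2 ([minimal_loop_holonomy]).  The base of a tower is an
    interval, so two closed trajectories of one tower lie in one strip
    ([tower_connected]); therefore the two strips are the two towers
    ([period_pair_two_towers]).

    Tessellation.  In homogeneous coordinates the reflection in the geodesic
    with ends c and d changes the sign of one coordinate in the basis (c, d)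
    ([reflection_comb]), and a regular ideal pentagon has the same coordinates
    in the bases given by each of its sides ([pentagon_side_child]).  So the
    pentagons correspond to words ([generation_node]).  Cones of different words
    of the same length have disjoint interiors ([cone_disjoint]), which yields
    all the points adjacent to beta ([adjacent_inner]).  They accumulate at beta
    monotonically on both sides ([neighbours_approach]), and this determines the
    enumeration gamma ([two_sided_enumeration]). *)

(** * The golden ratio *)

Section Golden.
Variable R : realType.
Local Notation phi := (@phi R).

Lemma phi_sq : phi * phi = phi + 1.
Proof.
have h5 : Num.sqrt 5 * Num.sqrt 5 = 5 :> R by rewrite -expr2 sqr_sqrtr.
rewrite /Defs.phi; move: (Num.sqrt 5) h5 => q h5.
have -> : (1 + q) / 2 * ((1 + q) / 2) = (1 + 2 * q + q * q) / 4 by field.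
by rewrite h5; field.
Qed.

Lemma phi_gt : 8 / 5 < phi.
Proof.
have h5 : Num.sqrt 5 * Num.sqrt 5 = 5 :> R by rewrite -expr2 sqr_sqrtr.
have h0 : 0 <= Num.sqrt 5 :> R by exact: sqrtr_ge0.
rewrite /Defs.phi; move: (Num.sqrt 5) h5 h0 => q h5 h0; nra.
Qed.

Lemma phi_lt : phi < 17 / 10.
Proof.
have h5 : Num.sqrt 5 * Num.sqrt 5 = 5 :> R by rewrite -expr2 sqr_sqrtr.
have h0 : 0 <= Num.sqrt 5 :> R by exact: sqrtr_ge0.
rewrite /Defs.phi; move: (Num.sqrt 5) h5 h0 => q h5 h0; nra.
Qed.

Lemma phi_gt0 : 0 < phi.
Proof. by have := phi_gt; lra. Qed.

End Golden.

(** * Subdivision of a sector *)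
Section SectorMap.
Variables (V : zmodType) (f : V -> V).

(** The matrix which takes the cone of u = (1, 0) and v = (0, 1) to the m-th
    cone between consecutive rays u, (phi, 1), (phi, phi), (1, phi), v, the
    vertices of one ideal pentagon.  Multiplication by phi is a parameter,
    because these matrices act both on real directions and on Z[phi]^2. *)
Definition sector_map (m : 'I_4) (p : V * V) : V * V :=
  match val m with
  | 0%N => (p.1 + f p.2, p.2)
  | 1%N => (f p.1 + f p.2, p.1 + f p.2)
  | 2%N => (f p.1 + p.2, f p.1 + f p.2)
  | _ => (p.1, f p.1 + p.2)
  end.

Definition word_map (w : seq 'I_4) (p : V * V) : V * V := foldr sector_map p w.

Lemma word_map_cat w1 w2 p : word_map (w1 ++ w2) p = word_map w1 (word_map w2 p).
Proof. exact: foldr_cat. Qed.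

Lemma word_map_rcons w m p : word_map (rcons w m) p = word_map w (sector_map m p).
Proof. exact: foldr_rcons. Qed.

End SectorMap.

(** * The first return map and its renormalization *)
Section RealDirections.
Variable R : realType.
Local Notation phi := (@phi R).

Definition rsector (m : 'I_4) (p : R * R) := sector_map ( *%R phi) m p.
Definition rword (w : seq 'I_4) (p : R * R) := word_map ( *%R phi) w p.

(** The intervals exchanged by the first return map F_d of the flow in direction
    d.  They are named after the sides of an L-shaped table affinely equivalent
    to X, whose left side and bottom are each made of a long and a short piece;
    F_d moves the left pieces to the right and the bottom ones to the left.  The
    intervals are half-open, which makes F_d a bijection of [0, width d) and
    leaves no exceptional orbits in the renormalization. *)
Inductive piece := LeftShort | LeftLong | BottomLong | BottomShort.

Definition lower (d : R * R) (a : piece) : R :=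
  match a with
  | LeftShort => 0
  | LeftLong => d.1
  | BottomLong => (phi + 1) * d.1
  | BottomShort => (phi + 1) * d.1 + phi * d.2
  end.

Definition upper (d : R * R) (a : piece) : R :=
  match a with
  | LeftShort => d.1
  | LeftLong => (phi + 1) * d.1
  | BottomLong => (phi + 1) * d.1 + phi * d.2
  | BottomShort => (phi + 1) * (d.1 + d.2)
  end.

Definition translation (d : R * R) (a : piece) : R :=
  match a with
  | LeftShort => phi * d.2
  | LeftLong => (phi + 1) * d.2
  | BottomLong => - ((phi + 1) * d.1)
  | BottomShort => - (phi * d.1)
  end.

Definition width (d : R * R) : R := (phi + 1) * (d.1 + d.2).

Fixpoint itinerary (d : R * R) (z : R) (w : seq piece) (z' : R) : Prop :=
  if w is a :: w1 then
    lower d a <= z < upper d a /\ itinerary d (z + translation d a) w1 z'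
  else z' = z.

Lemma itinerary_cat d z w1 z1 w2 z2 :
  itinerary d z w1 z1 -> itinerary d z1 w2 z2 -> itinerary d z (w1 ++ w2) z2.
Proof.
elim: w1 z => [|a w1 IH] z /= => [->//|[za zw] zw2]; split=> //.
exact: IH zw zw2.
Qed.

(** The itinerary under F_(sigma_m d) of a piece of F_d, until its first return
    to the interval on which F_(sigma_m d) induces F_d. *)
Definition substitute (m : 'I_4) (a : piece) : seq piece :=
  match val m, a with
  | 0%N, LeftShort => [:: LeftShort]
  | 0%N, LeftLong => [:: LeftLong]
  | 0%N, BottomLong => [:: LeftLong; BottomLong; LeftShort]
  | 0%N, BottomShort => [:: LeftLong; BottomShort]
  | 1%N, LeftShort => [:: LeftLong; BottomShort]
  | 1%N, LeftLong => [:: BottomLong; LeftShort; LeftLong]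
  | 1%N, BottomLong => [:: BottomLong; LeftShort; LeftLong; BottomShort]
  | 1%N, BottomShort => [:: BottomLong; LeftLong]
  | 2%N, LeftShort => [:: LeftLong; BottomLong]
  | 2%N, LeftLong => [:: LeftLong; BottomShort; BottomLong; LeftShort]
  | 2%N, BottomLong => [:: LeftLong; BottomShort; BottomLong]
  | 2%N, BottomShort => [:: BottomLong; LeftShort]
  | _, LeftShort => [:: BottomLong; LeftShort]
  | _, LeftLong => [:: BottomLong; LeftLong; BottomShort]
  | _, BottomLong => [:: BottomLong]
  | _, BottomShort => [:: BottomShort]
  end.

(** The left end of the interval of length [width d] on which F_(sigma_m d)
    induces F_d. *)
Definition offset (m : 'I_4) (d : R * R) : R :=
  match val m with
  | 0%N => phi * d.2
  | 1%N => (phi + 1) * (phi * d.1 + phi * d.2) - d.1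
  | 2%N => phi * d.1 + d.2
  | _ => (phi + 1) * d.1
  end.

(** Naming phi x turns inequalities that are polynomial in phi into linear ones
    in x and phi x, once phi^2 is replaced by phi + 1. *)
Lemma golden_multiple (x : R) : 0 <= x ->
  exists X, [/\ phi * x = X, x <= X <= 2 * x & phi * X = X + x].
Proof.
move=> x0; exists (phi * x); split=> //; last by rewrite mulrA phi_sq; ring.
by have := phi_gt R; have := phi_lt R; nra.
Qed.

End RealDirections.

Ltac linearize eX eY pX pY :=
  rewrite /width /offset /rsector /sector_map /=;
  do 3 rewrite ?mulrDl ?mulrDr ?mulrBr ?mulrN ?mul1r ?eX ?eY ?pX ?pY.

Section Renormalization.
Variable R : realType.
Local Notation phi := (@phi R).
Implicit Types d : R * R.

(** An affine symmetry of X takes direction d to direction sigma_m d, and a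
    transversal for d to one for sigma_m d; in coordinates this is a translation
    by [offset m d], and the time needed to return becomes a substitution. *)
Lemma itinerary_piece m d z a : 0 <= d.1 -> 0 <= d.2 ->
  lower d a <= z < upper d a ->
  itinerary (rsector m d) (z + offset m d) (substitute m a)
            (z + translation d a + offset m d).
Proof.
case: d => x y /= x0 y0.
have [X [eX hX pX]] := golden_multiple x0; have [Y [eY hY pY]] := golden_multiple y0.
case: m => [[|[|[|[|//]]]] lt_m] /andP[]; case: a => /=.
all: linearize eX eY pX pY => h1 h2.
all: repeat split; lra.
Qed.

(** Nothing is lost by inducing: the orbits of F_(sigma_m d) all meet the
    interval of induction.  The cases list the images of the pieces of F_d
    at the successive stages of their excursions. *)
Lemma itinerary_cover m d z : 0 <= d.1 -> 0 <= d.2 ->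
  0 <= z < width (rsector m d) ->
  exists z0 w, 0 <= z0 < width d /\
    itinerary (rsector m d) (z0 + offset m d) w z.
Proof.
case: d => x y /= x0 y0 /andP[].
have [X [eX hX pX]] := golden_multiple x0; have [Y [eY hY pY]] := golden_multiple y0.
case: m => [[|[|[|[|//]]]] lt_m].
all: linearize eX eY pX pY => z0 z1.
- case: (ltP z Y) => h1.
    exists (X + x + z), [:: LeftLong; BottomLong].
    by linearize eX eY pX pY; repeat split; lra.
  case: (ltP z (X + x + Y + Y + y)) => h2.
    by exists (z - Y), [::]; linearize eX eY pX pY; repeat split; lra.
  exists (z - (Y + Y + y)), [:: LeftLong].
  by linearize eX eY pX pY; repeat split; lra.
- case: (ltP z (X + Y + y)) => h1.
    exists (z + x), [:: BottomLong].
    by linearize eX eY pX pY; repeat split; lra.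
  case: (ltP z (X + X + Y + Y + y)) => h2.
    exists (z - (X + Y + y) + x), [:: BottomLong; LeftShort].
    by linearize eX eY pX pY; repeat split; lra.
  case: (ltP z (X + X + X + x + Y + Y + Y + y + y)) => h3.
    exists (z - (X + X + Y + Y + y)), [::].
    by linearize eX eY pX pY; repeat split; lra.
  case: (ltP z (X + X + X + x + Y + Y + Y + Y + y + y)) => h4.
    exists (X + x + (z - (X + X + X + x + Y + Y + Y + y + y))),
      [:: BottomLong; LeftShort; LeftLong].
    by linearize eX eY pX pY; repeat split; lra.
  exists (z - (X + X + X + x + Y + Y + Y + Y + y + y)), [:: LeftLong].
  by linearize eX eY pX pY; repeat split; lra.
- case: (ltP z y) => h1.
    exists (X + x + Y + z), [:: BottomLong].
    by linearize eX eY pX pY; repeat split; lra.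
  case: (ltP z (X + y)) => h2.
    exists (x + z - y), [:: LeftLong; BottomShort; BottomLong].
    by linearize eX eY pX pY; repeat split; lra.
  case: (ltP z (X + X + x + Y + y + y)) => h3.
    exists (z - (X + y)), [::].
    by linearize eX eY pX pY; repeat split; lra.
  case: (ltP z (X + X + X + x + Y + Y + y + y)) => h4.
    exists (z - (X + X + x + Y + y + y) + x), [:: LeftLong; BottomShort].
    by linearize eX eY pX pY; repeat split; lra.
  exists (z - (X + X + X + x + Y + Y + y + y)), [:: LeftLong].
  by linearize eX eY pX pY; repeat split; lra.
- case: (ltP z (X + x)) => h1.
    exists z, [:: BottomLong].
    by linearize eX eY pX pY; repeat split; lra.
  case: (ltP z (X + X + x + x + Y + y)) => h2.
    exists (z - (X + x)), [::].
    by linearize eX eY pX pY; repeat split; lra.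
  exists (z - (X + X + x + Y + y)), [:: BottomLong; LeftLong].
  by linearize eX eY pX pY; repeat split; lra.
Qed.
End Renormalization.

(** * Holonomy in Z[phi]^2 *)

(** The pair (a, b) stands for a + b phi. *)
Notation golden := (int * int)%type.

Definition gphi (a : golden) : golden := (a.2, a.1 + a.2).
Notation gvec := (golden * golden)%type.
Definition gvphi (h : gvec) : gvec := (gphi h.1, gphi h.2).
Definition gword (w : seq 'I_4) (h : gvec) : gvec := word_map gphi w h.

(** On the holonomy of a single piece this linear form is 1, so it counts the
    pieces of an itinerary.  Each piece stands for two crossed sides, hence
    the count is the Roman period. *)
Definition roman_count (h : gvec) : int := h.1.1 + h.1.2 + (h.2.1 + h.2.2).

(** The displacement along a piece, in units for which the translation of the
    piece is phi times the cross product of its holonomy with the direction. *)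
Definition holonomy1 (a : piece) : gvec :=
  match a with
  | LeftShort => ((1, 0), 0)
  | LeftLong => ((0, 1), 0)
  | BottomLong => (0, (0, 1))
  | BottomShort => (0, (1, 0))
  end.

Definition holonomy (w : seq piece) : gvec := \sum_(a <- w) holonomy1 a.

Lemma gvecP (h h' : gvec) : h.1.1 = h'.1.1 -> h.1.2 = h'.1.2 ->
  h.2.1 = h'.2.1 -> h.2.2 = h'.2.2 -> h = h'.
Proof. by case: h h' => [[a b] [c d]] [[a' b'] [c' d']] /= -> -> -> ->. Qed.

Lemma gvphiD h h' : gvphi (h + h') = gvphi h + gvphi h'.
Proof. by apply: gvecP => /=; ring. Qed.

Lemma gsectorD m (h h' : gvec) :
  sector_map gphi m (h + h') = sector_map gphi m h + sector_map gphi m h'.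
Proof.
by case: m => [[|[|[|[|//]]]] lt_m]; apply: gvecP => /=; ring.
Qed.

Lemma gwordD w (h h' : gvec) : gword w (h + h') = gword w h + gword w h'.
Proof.
by elim: w h h' => //= m w IH h h'; rewrite /gword /= -!/(gword _ _) IH gsectorD.
Qed.

Lemma gword_gvphi w h : gword w (gvphi h) = gvphi (gword w h).
Proof.
elim: w => //= m w IH; rewrite /gword /= -!/(gword _ _) IH.
move: (gword w h) => k.
by case: m => [[|[|[|[|//]]]] lt_m]; apply: gvecP => /=; ring.
Qed.

Lemma holonomy_cat w1 w2 : holonomy (w1 ++ w2) = holonomy w1 + holonomy w2.
Proof. exact: big_cat. Qed.

Lemma roman_countD h h' : roman_count (h + h') = roman_count h + roman_count h'.
Proof. by rewrite /roman_count /=; ring. Qed.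

Lemma size_holonomy w : (size w)%:Z = roman_count (holonomy w).
Proof.
elim: w => [|a w IH]; first by rewrite /holonomy big_nil.
rewrite /holonomy big_cons -/(holonomy w) roman_countD -IH /=.
by case: a; rewrite /roman_count /= -add1n PoszD; ring.
Qed.

Lemma holonomy_substitute m w :
  holonomy (flatten (map (substitute m) w)) = sector_map gphi m (holonomy w).
Proof.
have s0 : sector_map gphi m 0 = 0.
  by case: m => [[|[|[|[|//]]]] lt_m]; apply: gvecP.
have s1 a : holonomy (substitute m a) = sector_map gphi m (holonomy1 a).
  by case: m {s0} => [[|[|[|[|//]]]] lt_m]; case: a;
     rewrite /holonomy !big_cons big_nil; apply: gvecP.
elim: w => [|a w IH] /=; first by rewrite /holonomy !big_nil s0.
by rewrite holonomy_cat IH s1 -gsectorD /holonomy big_cons.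
Qed.

(** A closed orbit whose holonomy has this property is run through only once. *)
Definition indivisible (h : gvec) : Prop := forall (k : nat) h', h = h' *+ k -> k = 1%N.

Lemma mulrn_gvec (h : gvec) k :
  [/\ (h *+ k).1.1 = h.1.1 *+ k, (h *+ k).1.2 = h.1.2 *+ k,
      (h *+ k).2.1 = h.2.1 *+ k & (h *+ k).2.2 = h.2.2 *+ k].
Proof.
elim: k => [|k [IH1 IH2 IH3 IH4]]; first by rewrite !mulr0n.
by rewrite !mulrS /= IH1 IH2 IH3 IH4.
Qed.

(** A k-th part of f h yields a k-th part of h through the left inverse; used for
    the matrices [sector_map] and the multiplication by phi, which are invertible
    over Z[phi]. *)
Lemma indivisible_image (f g : gvec -> gvec) h : cancel f g ->
  {morph g : a b / a + b} -> indivisible h -> indivisible (f h).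
Proof.
move=> fK gD prim k h' e; apply: (prim k (g h')).
have g0 : g 0 = 0 by apply: (addrI (g 0)); rewrite -gD !addr0.
by rewrite -[h]fK e; elim: {e prim} k => [|k IH]; rewrite ?mulr0n // !mulrS gD IH.
Qed.

Lemma indivisible_phi h : indivisible h -> indivisible (gvphi h).
Proof.
pose gi (a : golden) : golden := (a.2 - a.1, a.1).
apply: (indivisible_image (g := fun h => (gi h.1, gi h.2))).
  by move=> k; apply: gvecP => /=; ring.
by move=> a b; apply: gvecP => /=; ring.
Qed.

Lemma indivisible_word w h : indivisible h -> indivisible (gword w h).
Proof.
move=> prim; elim: w => //= m w IH.
have F (p : gvec) : p = (p.1, p.2) by case: p.
pose g (p : gvec) : gvec := match val m with
  | 0%N => (p.1 - gphi p.2, p.2)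
  | 1%N => (gphi p.1 - gphi p.2, gphi p.2 - p.1)
  | 2%N => (gphi p.1 - p.2, gphi p.2 - gphi p.1)
  | _ => (p.1, p.2 - gphi p.1)
  end.
apply: (indivisible_image (g := g) _ _ IH).
  by rewrite /g; case: m {g} => [[|[|[|[|//]]]] lt_m] k; apply: gvecP => /=; ring.
by rewrite /g; case: m {g} => [[|[|[|[|//]]]] lt_m] a b; apply: gvecP => /=; ring.
Qed.
Definition gu : gvec := ((1, 0), 0).
Definition gv : gvec := (0, (1, 0)).

Lemma indivisible_gu : indivisible gu.
Proof.
move=> k h e; have [e1 _ _ _] := mulrn_gvec h k.
move: e1; rewrite -e /= => e1.
have : (1%N = `|h.1.1| * k)%N by move: e1; rewrite -mulr_natr => /(congr1 absz); rewrite abszM natz.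
by move=> /esym/eqP; rewrite muln_eq1 => /andP[_ /eqP].
Qed.

Lemma indivisible_gv : indivisible gv.
Proof.
move=> k h e; have [_ _ e1 _] := mulrn_gvec h k.
move: e1; rewrite -e /= => e1.
have : (1%N = `|h.2.1| * k)%N by move: e1; rewrite -mulr_natr => /(congr1 absz); rewrite abszM natz.
by move=> /esym/eqP; rewrite muln_eq1 => /andP[_ /eqP].
Qed.

(** * Towers of periodic orbits *)
Section Towers.
Variable R : realType.
Local Notation phi := (@phi R).

Definition gval (a : golden) : R := a.1%:~R + a.2%:~R * phi.
Definition gvval (h : gvec) : R * R := (gval h.1, gval h.2).

Lemma gval_phi a : gval (gphi a) = phi * gval a.
Proof.
rewrite /gval /= intrD; move: (a.1%:~R) (a.2%:~R) => x y.
have -> : phi * (x + y * phi) = phi * x + y * (phi * phi) by ring.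
by rewrite phi_sq; ring.
Qed.

Lemma gvalD a b : gval (a + b) = gval a + gval b.
Proof. by rewrite /gval /= !intrD; ring. Qed.

Lemma gvval_sector m h : gvval (sector_map gphi m h) = rsector m (gvval h).
Proof.
by case: m => [[|[|[|[|//]]]] lt_m]; rewrite /gvval /rsector /sector_map /= ?gvalD !gval_phi.
Qed.

Lemma gvval_word w h : gvval (gword w h) = rword w (gvval h).
Proof. by elim: w => //= m w IH; rewrite gvval_sector IH. Qed.

Lemma gvval_gu : gvval gu = (1, 0).
Proof. by rewrite /gvval /gval /= !mul0r !addr0. Qed.

Lemma gvval_gv : gvval gv = (0, 1).
Proof. by rewrite /gvval /gval /= !mul0r !addr0. Qed.

(** All points of the base share one itinerary.  This is what allows to pass from
    one periodic orbit to the nearby ones. *)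
Definition tower (d : R * R) (p q : R) (w : seq piece) : Prop :=
  forall z, p <= z < q -> itinerary d z w z.

(** The decomposition of X into two strips, seen on the transversal. *)
Definition two_towers (d : R * R) (h1 h2 : gvec) : Prop :=
  exists p1 q1 w1 p2 q2 w2,
    [/\ tower d p1 q1 w1 /\ holonomy w1 = h1,
        tower d p2 q2 w2 /\ holonomy w2 = h2 &
        forall z, 0 <= z < width d -> exists z0 w,
          (p1 <= z0 < q1 \/ p2 <= z0 < q2) /\ itinerary d z0 w z].

(** In the direction of a side F is the identity, and only two of the four
    intervals are non-empty. *)
Lemma two_towers_u : two_towers (1, 0) gu (gvphi gu).
Proof.
exists 0, 1, [:: LeftShort], 1, (phi + 1), [:: LeftLong].
split.
- split; last by rewrite /holonomy big_cons big_nil.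
  by move=> z hz; rewrite /= !mulr0 addr0.
- split; last by rewrite /holonomy big_cons big_nil; apply: gvecP.
  by move=> z hz; rewrite /= !mulr0 !mulr1 addr0.
move=> z; rewrite /width /= addr0 mulr1 => /andP[z0 z1].
exists z, [::]; split => //; case: (ltP z 1) => h; [left|right]; apply/andP; split; lra.
Qed.

Lemma two_towers_v : two_towers (0, 1) gv (gvphi gv).
Proof.
have pg := phi_gt R.
exists phi, (phi + 1), [:: BottomShort], 0, phi, [:: BottomLong].
split.
- split; last by rewrite /holonomy big_cons big_nil.
  by move=> z hz; rewrite /= !mulr0 oppr0 addr0 !mulr1 !add0r mulr1.
- split; last by rewrite /holonomy big_cons big_nil; apply: gvecP.
  by move=> z hz; rewrite /= !mulr0 oppr0 addr0 !mulr1 !add0r.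
move=> z; rewrite /width /= add0r mulr1 => /andP[z0 z1].
exists z, [::]; split => //; case: (ltP z phi) => h; [right|left]; apply/andP; split; lra.
Qed.

Lemma itinerary_substitute m (d : R * R) z w z' : 0 <= d.1 -> 0 <= d.2 ->
  itinerary d z w z' ->
  itinerary (rsector m d) (z + offset m d) (flatten (map (substitute m) w))
    (z' + offset m d).
Proof.
move=> d1 d2; elim: w z => [z /= ->//|a w IH z [za /IH zw]] /=.
exact: itinerary_cat (itinerary_piece m d1 d2 za) zw.
Qed.

Lemma two_towers_sector m (d : R * R) h1 h2 : 0 <= d.1 -> 0 <= d.2 -> two_towers d h1 h2 ->
  two_towers (rsector m d) (sector_map gphi m h1) (sector_map gphi m h2).
Proof.
move=> d1 d2 [p1 [q1 [w1 [p2 [q2 [w2 [[t1 e1] [t2 e2] cov]]]]]]].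
have T (p q : R) w : tower d p q w ->
    tower (rsector m d) (p + offset m d) (q + offset m d) (flatten (map (substitute m) w)).
  move=> t z /andP[z1 z2]; rewrite -[z](subrK (offset m d)).
  by apply: itinerary_substitute => //; apply: t; lra.
exists (p1 + offset m d), (q1 + offset m d), (flatten [seq substitute m a | a <- w1]).
exists (p2 + offset m d), (q2 + offset m d), (flatten (map (substitute m) w2)).
split; [by rewrite holonomy_substitute e1; split=> //; exact: T|
        by rewrite holonomy_substitute e2; split=> //; exact: T|].
move=> z /(itinerary_cover d1 d2)[z1 [w [/cov[z0 [w0 [hz0 it0]]] it]]].
exists (z0 + offset m d), (flatten (map (substitute m) w0) ++ w); split.
  by case: hz0 => h; [left|right]; lra.
exact: itinerary_cat (itinerary_substitute m d1 d2 it0) it.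
Qed.

Lemma rword_ge0 w (p : R * R) : 0 <= p.1 -> 0 <= p.2 ->
  0 <= (rword w p).1 /\ 0 <= (rword w p).2.
Proof.
move=> p1 p2; elim: w => //= m w [h1 h2]; have pp := phi_gt0 R.
rewrite /rword /= -/(rword w p) /sector_map.
by case: m => [[|[|[|[|//]]]] lt_m] /=; nra.
Qed.

Lemma two_towers_word w (e : R * R) h : 0 <= e.1 -> 0 <= e.2 ->
  two_towers e h (gvphi h) ->
  two_towers (rword w e) (gword w h) (gvphi (gword w h)).
Proof.
move=> e1 e2 tw; elim: w => //= m w IH.
rewrite -(gword_gvphi (m :: w)) /= gword_gvphi.
by have [h1 h2] := rword_ge0 w e1 e2; exact: two_towers_sector.
Qed.
End Towers.

(** * Periodic orbits of the first return map *)
Section Loops.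
Variables (R : realType) (d : R * R).
Hypotheses (d1 : 0 <= d.1) (d2 : 0 <= d.2).
Local Notation phi := (@phi R).

Lemma piece_unique z a b :
  lower d a <= z < upper d a -> lower d b <= z < upper d b -> a = b.
Proof.
have [X [eX hX pX]] := golden_multiple d1; have [Y [eY hY pY]] := golden_multiple d2.
by case: a; case: b => //=; linearize eX eY pX pY => /andP[? ?] /andP[? ?]; exfalso; lra.
Qed.

Lemma itinerary_prefix z w1 z1 w2 z2 :
  itinerary d z w1 z1 -> itinerary d z w2 z2 -> (size w1 <= size w2)%N ->
  exists2 w3, w2 = w1 ++ w3 & itinerary d z1 w3 z2.
Proof.
elim: w1 z w2 => [|a w1 IH] z w2 /=; first by move=> -> it _; exists w2.
case: w2 => [|b w2] //=.
case=> za it1 [zb it2]; rewrite ltnS => hs.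
rewrite -(piece_unique za zb) in it2 *.
by have [w3 -> it3] := IH _ _ it1 it2 hs; exists w3.
Qed.

Lemma itinerary_det z w1 z1 w2 z2 :
  itinerary d z w1 z1 -> itinerary d z w2 z2 -> size w1 = size w2 -> z1 = z2.
Proof.
move=> it1 it2 es; have [|[|a w3] e it3] := itinerary_prefix it1 it2; first by rewrite es.
  by rewrite it3.
by move: es; rewrite e size_cat /= => es; exfalso; lia.
Qed.

(** Move the starting point of the loop along the orbit: the two parts of the
    itinerary are exchanged, which preserves holonomy. *)
Lemma tower_loop p q w z0 v z :
  tower d p q w -> (0 < size w)%N -> p <= z0 < q -> itinerary d z0 v z ->
  exists w' v', [/\ itinerary d z w' z, holonomy w' = holonomy w, (0 < size w')%N &
    itinerary d z v' z0].
Proof.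
move=> t wn hz; have it0 := t _ hz.
have [n] := ubnP (size v); elim: n v => // n IH v hn it.
have [h|h] := leqP (size w) (size v).
  have [v3 ev it3] := itinerary_prefix it0 it h.
  apply: (IH v3 _ it3); move: hn; rewrite ev.
  by rewrite size_cat; lia.
have [w3 ew it3] := itinerary_prefix it it0 (ltnW h).
exists (w3 ++ v), w3; split=> //; first exact: itinerary_cat it3 it.
  by rewrite ew !holonomy_cat addrC.
by move: wn; rewrite ew !size_cat addnC.
Qed.

Definition minimal_loop (z : R) (w : seq piece) : Prop :=
  [/\ (0 < size w)%N, itinerary d z w z &
      forall v, itinerary d z v z -> (0 < size v)%N -> (size w <= size v)%N].

Lemma minimal_loop_multiple z w v : minimal_loop z w -> itinerary d z v z ->
  exists k, holonomy v = holonomy w *+ k.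
Proof.
case=> wn itw mw; have [n] := ubnP (size v); elim: n v => // n IH v hn itv.
have [/size0nil->|vn] := posnP (size v); first by exists 0%N; rewrite /holonomy big_nil.
have [v3 ev it3] := itinerary_prefix itw itv (mw _ itv vn).
have [|k ek] := IH v3 _ it3.
  by move: hn; rewrite ev size_cat; lia.
by exists k.+1; rewrite ev holonomy_cat ek mulrS.
Qed.

(** A loop around the tower is a multiple of the minimal loop, and
    indivisibility makes the factor 1. *)
Lemma minimal_loop_holonomy p q w z0 v z c : tower d p q w -> (0 < size w)%N ->
  p <= z0 < q -> itinerary d z0 v z -> indivisible (holonomy w) ->
  minimal_loop z c ->
  holonomy c = holonomy w /\ exists v', itinerary d z v' z0.
Proof.
move=> t wn hz it prim mc.
have [w' [v' [itw' hw' _ itv']]] := tower_loop t wn hz it.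
have [k ek] := minimal_loop_multiple mc itw'.
split; last by exists v'.
by rewrite -hw' ek (prim k (holonomy c)) // -hw'.
Qed.

(** Orbits which avoid the ends of the intervals correspond to trajectories that
    never meet a vertex of P. *)
Fixpoint inner_itinerary (z : R) (w : seq piece) (z' : R) : Prop :=
  if w is a :: w1 then
    lower d a < z < upper d a /\ inner_itinerary (z + translation d a) w1 z'
  else z' = z.

Lemma inner_itineraryW z w z' : inner_itinerary z w z' -> itinerary d z w z'.
Proof.
by elim: w z => //= a w IH z [/andP[h1 h2] /IH h]; split=> //; rewrite (ltW h1).
Qed.

(** Since the intervals contain their left ends only, a point to the right of
    another one with the same itinerary stays inside the intervals. *)
Lemma itinerary_inner p w p' z z' :
  itinerary d p w p' -> itinerary d z w z' -> p < z -> inner_itinerary z w z'.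
Proof.
elim: w p z => //= a w IH p z [/andP[p1 p2] itp] [/andP[z1 z2] itz] pz; split.
  by rewrite z2 (le_lt_trans p1).
by apply: IH itp itz _; rewrite ltrD2r.
Qed.
End Loops.

(** * Coordinates of the regular pentagon *)
Section Trigonometry.
Variable R : realType.
Local Notation phi := (@phi R).

Lemma sin_pi_sub (x : R) : sin (pi - x) = sin x.
Proof. by rewrite addrC sinDpi sinN opprK. Qed.

Lemma cos_pi_sub (x : R) : cos (pi - x) = - cos x.
Proof. by rewrite addrC cosDpi cosN. Qed.

Lemma sin_pi5_gt0 : 0 < sin (pi / 5 : R).
Proof. by have := pi_gt0 R => h; apply: sin_gt0_pi; apply/andP; split; lra. Qed.

(** Three and two times 36 degrees add up to 180 degrees, hence have the same
    sine; dividing by sin 36 gives a quadratic equation for the cosine. *)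
Lemma cos_pi5 : cos (pi / 5 : R) = phi / 2.
Proof.
have pp := pi_gt0 R; have s0 := sin_pi5_gt0.
have c0 : 0 < cos (pi / 5 : R) by apply: cos_gt0_pihalf; apply/andP; split; lra.
have h : sin (pi / 5 + (pi / 5 + pi / 5) : R) = sin (pi / 5 + pi / 5).
  by rewrite -[RHS]sin_pi_sub; congr sin; field.
have := cos2Dsin2 (pi / 5 : R).
move: h; rewrite sinD cosD sinD.
move: (sin _) (cos _) s0 c0 => s c s0 c0 h h1.
have e : s * (4 * (c * c) - 2 * c - 1) = 0 by nra.
have /eqP := e; rewrite mulf_eq0 gt_eqF //= => /eqP e1.
have := phi_sq R; have := phi_gt R => pg ps.
have : (2 * c - phi) * (2 * c + phi - 1) = 0 by nra.
by move/eqP; rewrite mulf_eq0 => /orP[]/eqP; lra.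
Qed.

Definition sin72 : R := sin (2 * pi / 5).

Lemma sin72_gt0 : 0 < sin72.
Proof. by have := pi_gt0 R => h; apply: sin_gt0_pi; apply/andP; split; lra. Qed.

Lemma sin_pi5 : sin (pi / 5 : R) = (phi - 1) * sin72.
Proof.
have -> : sin72 = sin (pi / 5 + pi / 5) by rewrite /sin72; congr sin; field.
rewrite sinD cos_pi5; move: (sin _) => s.
have -> : (phi - 1) * (s * (phi / 2) + phi / 2 * s) = (phi * phi - phi) * s by field.
by rewrite phi_sq; ring.
Qed.

Lemma cos_2pi5 : cos (2 * pi / 5 : R) = (phi - 1) / 2.
Proof.
have -> : 2 * pi / 5 = pi / 5 + pi / 5 :> R by field.
rewrite cosD cos_pi5; have := cos2Dsin2 (pi / 5 : R); rewrite cos_pi5.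
by have := phi_sq R; nra.
Qed.

Definition side_dir (j : nat) : R * R :=
  match j with
  | 0%N => (1, 0)
  | 1%N => ((phi - 1) / 2, sin72)
  | 2%N => (- (phi / 2), (phi - 1) * sin72)
  | 3%N => (- (phi / 2), - ((phi - 1) * sin72))
  | _ => ((phi - 1) / 2, - sin72)
  end.

Lemma side_vectorE j : (j < 5)%N -> side_vector j = side_dir j.
Proof.
case: j => [|[|[|[|[|//]]]]] _; rewrite /side_vector /=.
- by rewrite mulr0 mul0r cos0 sin0.
- by rewrite mulr1 cos_2pi5.
- have -> : 2 * pi * 2 / 5 = pi - pi / 5 :> R by field.
  by rewrite cos_pi_sub sin_pi_sub cos_pi5 sin_pi5.
- have -> : 2 * pi * 3 / 5 = pi / 5 + pi :> R by field.
  by rewrite cosDpi sinDpi cos_pi5 sin_pi5.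
- have -> : 2 * pi * 4 / 5 = - (2 * pi / 5) + pi + pi :> R by field.
  by rewrite !cosDpi !sinDpi cosN sinN cos_2pi5 !opprK.
Qed.
End Trigonometry.

(** * Crossing P and P' *)
Section PentagonFlow.
Variable R : realType.
Local Notation phi := (@phi R).
Local Notation sin72 := (sin72 R).

Definition wedge (a b : R * R) : R := a.1 * b.2 - a.2 * b.1.

Definition side_point (j : nat) (t : R) : R * R :=
  match j with
  | 0%N => (t, 0)
  | 1%N => (1 + t * ((phi - 1) / 2), t * sin72)
  | 2%N => (1 + (phi - 1) / 2 - t * (phi / 2), sin72 + t * ((phi - 1) * sin72))
  | 3%N => (2^-1 - t * (phi / 2), phi * sin72 - t * ((phi - 1) * sin72))
  | _ => ((t - 1) * ((phi - 1) / 2), (1 - t) * sin72)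
  end.

Lemma position_falseE (c : 'I_5 * R) : position false c = side_point c.1 c.2.
Proof.
case: c => [[j lt_j] t]; rewrite /position /= /corner.
rewrite side_vectorE // (eq_bigr (fun i : 'I_j => side_dir R i)); last first.
  by move=> i _; rewrite side_vectorE // (ltn_trans (ltn_ord i)).
move: lt_j; case: j => [|[|[|[|[|//]]]]] _.
all: rewrite ?big_ord_recr big_ord0 /=.
all: congr pair; rewrite /GRing.scale /=.
all: by rewrite /= -![t *: _]/(t * _); field.
Qed.

Lemma position_trueE (c : 'I_5 * R) : position true c = - side_point c.1 (1 - c.2).
Proof. by rewrite -(position_falseE (c.1, 1 - c.2)). Qed.

(** Convexity of P: all its points except those of side i are strictly to the
    left of that side.  This tells which of two crossings comes first. *)
Lemma side_point_inside i j (s t : R) : (i < 5)%N -> (j < 5)%N -> i != j -> 0 < t < 1 ->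
  0 < wedge (side_dir R i) (side_point j t - side_point i s).
Proof.
move=> hi hj hij /andP[t0 t1].
have S0 := sin72_gt0 R; have pg := phi_gt R; have pl := phi_lt R; have pp := phi_sq R.
(* In each case the cross product is linear in sin72 * t and sin72 * (1 - t),
   with coefficients of degree 1 in phi after reduction. *)
have h1 : 0 < sin72 * t by nra.
have h2 : 0 < sin72 * (1 - t) by nra.
have h3 : 0 < (phi - 8 / 5) * (sin72 * t) by nra.
have h4 : 0 < (phi - 8 / 5) * (sin72 * (1 - t)) by nra.
have h5 : 0 < (17 / 10 - phi) * (sin72 * t) by nra.
have h6 : 0 < (17 / 10 - phi) * (sin72 * (1 - t)) by nra.
have e1 : (phi * phi) * (sin72 * t) = (phi + 1) * (sin72 * t) by rewrite pp.
have e2 : (phi * phi) * sin72 = (phi + 1) * sin72 by rewrite pp.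
rewrite /wedge.
case: i hi hij => [|[|[|[|[|//]]]]] _; case: j hj => [|[|[|[|[|//]]]]] _ //= _.
all: lra.
Qed.

Variables (d : R * R) (kap : R) (D : R * R).

(** The width of side j seen in direction d, positive when the flow
    enters P through this side. *)
Definition side_weight (j : nat) : R :=
  match j with
  | 0%N => phi * (d.1 + d.2)
  | 1%N => d.1
  | 2%N => - (d.1 + phi * d.2)
  | 3%N => - (phi * d.1 + d.2)
  | _ => d.2
  end.

(** The coordinate across the flow of the point of side j at distance t from its
    start, as a point of P; it runs from 0 to [width d] from left to right. *)
Definition coord_P (j : nat) (t : R) : R :=
  match j with
  | 0%N => d.2 + t * (phi * (d.1 + d.2))
  | 1%N => d.2 + phi * (d.1 + d.2) + t * d.1
  | 2%N => (phi + 1) * (d.1 + d.2) - t * (d.1 + phi * d.2)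
  | 3%N => (1 - t) * (phi * d.1 + d.2)
  | _ => t * d.2
  end.

(** The same coordinate for the corresponding point of P'. *)
Definition coord_P' (j : nat) (t : R) : R :=
  match j with
  | 0%N => d.1 + t * (phi * (d.1 + d.2))
  | 1%N => t * d.1
  | 2%N => (1 - t) * (d.1 + phi * d.2)
  | 3%N => d.1 + phi * d.2 + (1 - t) * (phi * d.1 + d.2)
  | _ => phi * (d.1 + d.2) + d.1 + t * d.2
  end.

(** D is the actual direction in the plane and d = (x, y) its coordinates in the
    sector: x and y are proportional to the widths of the two sides next to the
    bottom, which vanish in the directions 72 and 108 degrees. *)
Definition aligned : Prop :=
  D.2 = kap * (phi * (d.1 + d.2)) /\ 2 * sin72 * D.1 = kap * (d.2 - d.1).

Lemma wedge_side j : aligned -> (j < 5)%N -> wedge (side_dir R j) D = kap * side_weight j.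
Proof.
case=> D2 D1; have pp := phi_sq R.
have e1 : sin72 * D.1 = kap * (d.2 - d.1) / 2 by rewrite -D1; field.
have pk : (phi * phi) * kap = (phi + 1) * kap by rewrite pp.
have pk1 : (phi * phi) * kap * d.1 = (phi + 1) * kap * d.1 by rewrite pp.
have pk2 : (phi * phi) * kap * d.2 = (phi + 1) * kap * d.2 by rewrite pp.
have e2 : phi * (sin72 * D.1) = phi * (kap * (d.2 - d.1) / 2) by rewrite e1.
by rewrite /wedge D2; case: j => [|[|[|[|[|//]]]]] _ /=; lra.
Qed.

Lemma wedge_coord_P j t : aligned -> (j < 5)%N ->
  wedge (side_point j t) D = kap * (coord_P j t - d.2).
Proof.
case=> D2 D1; have pp := phi_sq R.
have e1 : sin72 * D.1 = kap * (d.2 - d.1) / 2 by rewrite -D1; field.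
have e2 : phi * (sin72 * D.1) = phi * (kap * (d.2 - d.1) / 2) by rewrite e1.
have e3 : t * (sin72 * D.1) = t * (kap * (d.2 - d.1) / 2) by rewrite e1.
have e4 : t * (phi * (sin72 * D.1)) = t * (phi * (kap * (d.2 - d.1) / 2)) by rewrite e1.
have pk1 : (phi * phi) * kap * d.1 = (phi + 1) * kap * d.1 by rewrite pp.
have pk2 : (phi * phi) * kap * d.2 = (phi + 1) * kap * d.2 by rewrite pp.
have pk3 : (phi * phi) * kap * d.1 * t = (phi + 1) * kap * d.1 * t by rewrite pp.
have pk4 : (phi * phi) * kap * d.2 * t = (phi + 1) * kap * d.2 * t by rewrite pp.
by rewrite /wedge D2; case: j => [|[|[|[|[|//]]]]] _ /=; lra.
Qed.

Lemma coord_PP' j t : aligned -> (j < 5)%N ->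
  wedge (side_point j (1 - t)) D = - (kap * (coord_P' j t - phi * (d.1 + d.2) - d.1)).
Proof.
move=> aD hj; rewrite wedge_coord_P //.
by case: j hj => [|[|[|[|[|//]]]]] _ /=; ring.
Qed.

Definition crosses (c c' : 'I_5 * R) : Prop :=
  [/\ on_open_side c, on_open_side c', c.1 != c'.1 &
      exists copy : bool, exists2 l : R, 0 < l &
        position copy c' - position copy c = l *: D].

Hypotheses (aD : aligned) (kap0 : 0 < kap).

Lemma wedgeNr a b : wedge a (- b) = - wedge a b.
Proof. by rewrite /wedge /=; ring. Qed.
Lemma wedgeDl a b c : wedge (b + c) a = wedge b a + wedge c a.
Proof. by rewrite /wedge /=; ring. Qed.
Lemma wedgeNl a b : wedge (- b) a = - wedge b a.
Proof. by rewrite /wedge /=; ring. Qed.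
Lemma wedgeZr l a b : wedge a (l *: b) = l * wedge a b.
Proof. by rewrite /wedge /= -![l *: _]/(l * _); ring. Qed.

(** The coordinate across the flow is constant along it, and convexity decides
    through which sides P and P' are entered and left. *)
Lemma crosses_coord c c' : crosses c c' ->
  [/\ 0 < side_weight c.1, side_weight c'.1 < 0 & coord_P c.1 c.2 = coord_P c'.1 c'.2] \/
  [/\ side_weight c.1 < 0, 0 < side_weight c'.1 & coord_P' c.1 c.2 = coord_P' c'.1 c'.2].
Proof.
move=> [os os' ne [[] [l l0]]].
  rewrite !position_trueE => e; right.
  have o1 : 0 < 1 - c.2 < 1 by move: os; rewrite /on_open_side; lra.
  have o1' : 0 < 1 - c'.2 < 1 by move: os'; rewrite /on_open_side; lra.
  have h1 := side_point_inside (1 - c.2) (ltn_ord c.1) (ltn_ord c'.1) ne o1'.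
  rewrite eq_sym in ne.
  have h2 := side_point_inside (1 - c'.2) (ltn_ord c'.1) (ltn_ord c.1) ne o1.
  have e1 : side_point c'.1 (1 - c'.2) - side_point c.1 (1 - c.2) = - (l *: D).
    by rewrite -e opprB opprK addrC.
  have e2 : side_point c.1 (1 - c.2) - side_point c'.1 (1 - c'.2) = l *: D.
    by rewrite -e opprK addrC.
  move: h1 h2; rewrite e1 e2 wedgeNr !wedgeZr !wedge_side //.
  move=> h1 h2; split; [by rewrite -(pmulr_rlt0 _ kap0) -(pmulr_rlt0 _ l0) -oppr_gt0|
    by rewrite -(pmulr_rgt0 _ kap0) -(pmulr_rgt0 _ l0)|].
  have : wedge (l *: D) D = 0 by rewrite /wedge /= -![l *: _]/(l * _); ring.
  rewrite -e2 wedgeDl wedgeNl !coord_PP' // => e3.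
  have : kap * (coord_P' c'.1 c'.2 - coord_P' c.1 c.2) = 0 by rewrite -[RHS]e3; ring.
  by move/eqP; rewrite mulf_eq0 gt_eqF //= subr_eq0 => /eqP.
rewrite !position_falseE => e; left.
have h1 := side_point_inside c.2 (ltn_ord c.1) (ltn_ord c'.1) ne os'.
rewrite eq_sym in ne.
have h2 := side_point_inside c'.2 (ltn_ord c'.1) (ltn_ord c.1) ne os.
have e2 : side_point c.1 c.2 - side_point c'.1 c'.2 = - (l *: D) by rewrite -e opprB.
move: h1 h2; rewrite e e2 wedgeNr !wedgeZr !wedge_side //.
move=> h1 h2; split; [by rewrite -(pmulr_rgt0 _ kap0) -(pmulr_rgt0 _ l0)|
  by rewrite -(pmulr_rlt0 _ kap0) -(pmulr_rlt0 _ l0) -oppr_gt0|].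
have : wedge (l *: D) D = 0 by rewrite /wedge /= -![l *: _]/(l * _); ring.
rewrite -e wedgeDl wedgeNl !wedge_coord_P // => e3.
have : kap * (coord_P c'.1 c'.2 - coord_P c.1 c.2) = 0 by rewrite -[RHS]e3; ring.
by move/eqP; rewrite mulf_eq0 gt_eqF //= subr_eq0 => /eqP.
Qed.

Lemma parallel_scale (a : R * R) : D.2 != 0 -> wedge a D = 0 -> exists l, a = l *: D.
Proof.
move=> D0 h; exists (a.2 / D.2); case: a h => a1 a2; rewrite /wedge /= => h.
congr pair; rewrite /= -[LHS]/(_) -[RHS]/(_ * _); last by rewrite mulfVK.
by apply: (mulIf D0); rewrite mulrAC mulfVK //; lra.
Qed.

Hypotheses (d1 : 0 <= d.1) (d2 : 0 <= d.2) (d0 : 0 < d.1 + d.2).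

Lemma D2_gt0 : 0 < D.2.
Proof. by case: aD => -> _; rewrite !mulr_gt0 // phi_gt0. Qed.

Lemma crosses_intro_P c c' : on_open_side c -> on_open_side c' ->
  0 < side_weight c.1 -> side_weight c'.1 < 0 -> coord_P c.1 c.2 = coord_P c'.1 c'.2 ->
  crosses c c'.
Proof.
move=> os os' w w' e.
have ne : c.1 != c'.1 by apply/eqP => h; move: w w'; rewrite h; lra.
split=> //; exists false; rewrite !position_falseE.
have h1 := side_point_inside c.2 (ltn_ord c.1) (ltn_ord c'.1) ne os'.
have [| |l el] := @parallel_scale (side_point c'.1 c'.2 - side_point c.1 c.2).
- by rewrite gt_eqF // D2_gt0.
- by rewrite wedgeDl wedgeNl !wedge_coord_P // e subrr.
exists l => //; move: h1; rewrite el wedgeZr wedge_side // mulrA => h1.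
by move: h1; rewrite pmulr_lgt0 // pmulr_lgt0.
Qed.

Lemma crosses_intro_P' c c' : on_open_side c -> on_open_side c' ->
  side_weight c.1 < 0 -> 0 < side_weight c'.1 -> coord_P' c.1 c.2 = coord_P' c'.1 c'.2 ->
  crosses c c'.
Proof.
move=> os os' w w' e.
have ne : c'.1 != c.1 by apply/eqP => h; move: w w'; rewrite h; lra.
split=> //; first by rewrite eq_sym.
exists true; rewrite !position_trueE.
have o1 : 0 < 1 - c.2 < 1 by move: os; rewrite /on_open_side; lra.
have h1 := side_point_inside (1 - c'.2) (ltn_ord c'.1) (ltn_ord c.1) ne o1.
have [| |l el] := @parallel_scale (side_point c.1 (1 - c.2) - side_point c'.1 (1 - c'.2)).
- by rewrite gt_eqF // D2_gt0.
- by rewrite wedgeDl wedgeNl !coord_PP' // e subrr.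
exists l; last by rewrite -el opprK addrC.
move: h1; rewrite el wedgeZr wedge_side // mulrA => h1.
by move: h1; rewrite pmulr_lgt0 // pmulr_lgt0.
Qed.

End PentagonFlow.

(** * Trajectories as orbits of the first return map *)
Section Coding.
Variable R : realType.
Local Notation phi := (@phi R).
Variables (d : R * R) (kap : R) (D : R * R).
Hypotheses (aD : aligned d kap D) (kap0 : 0 < kap).
Hypotheses (d1 : 0 <= d.1) (d2 : 0 <= d.2) (d0 : 0 < d.1 + d.2).
Local Notation crosses := (crosses D).

(** In the directions of the third sector the flow leaves P through its two upper sides, of indices 2 and 3. *)
Definition on_roof (c : 'I_5 * R) : bool := ((val c.1 == 2) || (val c.1 == 3))%N.
(** The two upper sides of P, put end to end as lower sides of P', form a
    transversal of coordinate 0 to [width d]. *)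
Definition section_coord (c : 'I_5 * R) : R := coord_P' d c.1 c.2.

Lemma cut_gt0 : 0 < d.1 + phi * d.2 /\ 0 < phi * d.1 + d.2.
Proof.
have pg := phi_gt R; have h1 : d.1 <= phi * d.1 by rewrite ler_peMl //; lra.
have h2 : d.2 <= phi * d.2 by rewrite ler_peMl //; lra.
have q1 := d1; have q2 := d2; have q0 := d0.
by split; lra.
Qed.

Lemma side_weight_roof (c : 'I_5 * R) : (side_weight d c.1 < 0) = on_roof c.
Proof.
have q1 := d1; have q2 := d2; have q0 := d0.
have [h1 h2] := cut_gt0; have pg := phi_gt R.
have h3 : 0 <= phi * (d.1 + d.2) by rewrite mulr_ge0 ?addr_ge0 // (ltW (phi_gt0 R)).
case: c => [[[|[|[|[|[|//]]]]] lt_j] t]; rewrite /on_roof /=.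
all: by case: ltP => //= h; exfalso; lra.
Qed.

Lemma section_coord_range c : on_roof c -> on_open_side c ->
  if val c.1 == 2%N then 0 < section_coord c < d.1 + phi * d.2
  else d.1 + phi * d.2 < section_coord c < width d.
Proof.
have q1 := d1; have q2 := d2; have q0 := d0.
have [h1 h2] := cut_gt0.
case: c => [[[|[|[|[|[|//]]]]] lt_j] t]; rewrite /on_roof //= => _ /andP[/= t0 t1].
all: rewrite /section_coord /width /=; apply/andP; split; nra.
Qed.

Lemma section_coord_inj c c' : on_roof c -> on_roof c' -> on_open_side c ->
  on_open_side c' -> section_coord c = section_coord c' -> c = c'.
Proof.
have q1 := d1; have q2 := d2; have q0 := d0.
move=> r r' os os' e.
have := section_coord_range r os; have := section_coord_range r' os'; rewrite e.
have [h1 h2] := cut_gt0.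
have F (j j' : 'I_5) (t t' : R) : val j = val j' -> t = t' -> (j, t) = (j', t').
  by move=> /val_inj-> ->.
move: c c' r r' e {os os'} => [[[|[|[|[|[|//]]]]] lt_j] t] [[[|[|[|[|[|//]]]]] lt_j'] t'] //=.
all: rewrite /section_coord /= => _ _ e.
- move=> _ _; apply: F => //; have : (t - t') * (d.1 + phi * d.2) = 0 by lra.
  by move/eqP; rewrite mulf_eq0 (gt_eqF h1) orbF subr_eq0 => /eqP.
- by move=> /andP[? ?] /andP[? ?]; exfalso; lra.
- by move=> /andP[? ?] /andP[? ?]; exfalso; lra.
- move=> _ _; apply: F => //; have : (t - t') * (phi * d.1 + d.2) = 0 by lra.
  by move/eqP; rewrite mulf_eq0 (gt_eqF h2) orbF subr_eq0 => /eqP.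
Qed.

Lemma crosses_roof c c' : crosses c c' -> on_roof c' = ~~ on_roof c.
Proof.
have q1 := d1; have q2 := d2; have q0 := d0.
by case/(crosses_coord aD kap0) => [] [w w' _]; rewrite -!side_weight_roof;
   [rewrite w' ltNge (ltW w) | rewrite w ltNge (ltW w')].
Qed.

(** Crossing P' reverses the order of three intervals (sides 1, 0, 4) and crossing
    P exchanges two (sides 2, 3); the composition is F_d. *)
Lemma crosses_twice c c' c'' : on_roof c -> crosses c c' -> crosses c' c'' ->
  exists2 a, lower d a < section_coord c < upper d a &
    section_coord c'' = section_coord c + translation d a.
Proof.
have q1 := d1; have q2 := d2; have q0 := d0.
move=> r k1 k2; have r' := crosses_roof k1; have r'' := crosses_roof k2.
rewrite r in r'; rewrite r' /= in r''.
have [_ os' _ _] := k1; have [_ os'' _ _] := k2.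
case/(crosses_coord aD kap0): k1 => [] [w w' e1].
  by move: w; rewrite ltNge le_eqVlt side_weight_roof r orbT.
case/(crosses_coord aD kap0): k2 => [] [v v' e2]; last first.
  by move: w'; rewrite ltNge le_eqVlt v orbT.
rewrite /section_coord e1; move: e2 r' r'' w' os' os'' {e1 w v v' r}.
have [h1 h2] := cut_gt0; have pg := phi_gt R.
have h3 : 0 < phi * (d.1 + d.2) by rewrite mulr_gt0 // (phi_gt0 R).
have p1 : 0 <= phi * d.1 by rewrite mulr_ge0 // (ltW (phi_gt0 R)).
have p2 : 0 <= phi * d.2 by rewrite mulr_ge0 // (ltW (phi_gt0 R)).
case: c' c'' => [[j' lt_j'] t'] [[j'' lt_j''] t''].
rewrite /on_roof /on_open_side /= => e2 r' r'' w' /andP[t0 t1] /andP[s0 s1].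
move: r'' r' w' e2 {lt_j' lt_j''}.
(* P' is left through side j' and P through side j''; the pairs (1, 3) and (4, 2)
   do not occur, because these sides do not overlap across the flow. *)
case: j'' => [|[|[|[|j'']]]] //=; case: j' => [|[|[|[|j']]]] //= _ _ w' e2.
- have k1' : 0 < (1 - t'') * (d.1 + phi * d.2) by nra.
  have k2' : 0 < (1 - t') * (phi * (d.1 + d.2)) by nra.
  have k3' : 0 < t'' * (d.1 + phi * d.2) by nra.
  by exists BottomLong => /=; [apply/andP; split; lra | lra].
- have k1' : 0 < (1 - t') * d.1 by nra.
  have k2' : 0 < t' * d.1 by nra.
  by exists LeftShort => /=; [apply/andP; split; lra | lra].
- have k1' : 0 < (1 - t') * d.2 by nra.
  have k3' : 0 < (1 - t'') * (d.1 + phi * d.2) by nra.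
  by exfalso; lra.
- have k1' : 0 < (1 - t'') * (phi * d.1 + d.2) by nra.
  have k2' : 0 < t' * (phi * (d.1 + d.2)) by nra.
  have k3' : 0 < t'' * (phi * d.1 + d.2) by nra.
  by exists LeftLong => /=; [apply/andP; split; lra | lra].
- have k2' : 0 < t' * d.1 by nra.
  have k3' : 0 < t'' * (phi * d.1 + d.2) by nra.
  by exfalso; lra.
- have k1' : 0 < (1 - t') * d.2 by nra.
  have k2' : 0 < t' * d.2 by nra.
  by exists BottomShort => /=; [apply/andP; split; lra | lra].
Qed.

(** The transversal without its ends and without the vertex common to its two
    sides. *)
Definition regular (z : R) : Prop := 0 < z < width d /\ z != d.1 + phi * d.2.

Definition roof_crossing (z : R) : 'I_5 * R :=
  if z < d.1 + phi * d.2 then (@Ordinal 5 2 isT, 1 - z / (d.1 + phi * d.2))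
  else (@Ordinal 5 3 isT, 1 - (z - (d.1 + phi * d.2)) / (phi * d.1 + d.2)).

Lemma roof_crossingP z : regular z ->
  [/\ on_roof (roof_crossing z), on_open_side (roof_crossing z) &
      section_coord (roof_crossing z) = z].
Proof.
have q1 := d1; have q2 := d2; have q0 := d0.
move=> [/andP[z0 z1] zn]; have [h1 h2] := cut_gt0; rewrite /roof_crossing.
have wE : width d = d.1 + phi * d.2 + (phi * d.1 + d.2) by rewrite /width; ring.
have [h|h] := ltP z.
  split=> //; last by rewrite /section_coord /= opprB addrC subrK divfK // gt_eqF.
  by rewrite /on_open_side /= subr_gt0 gtrBl divr_gt0 // ltr_pdivrMr // mul1r h.
have {zn} h3 : d.1 + phi * d.2 < z by rewrite lt_neqAle eq_sym zn.
split=> //; last first.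
  by rewrite /section_coord /= opprB [1 + _]addrC subrK divfK ?gt_eqF // addrC subrK.
rewrite /on_open_side /= subr_gt0 gtrBl divr_gt0 // ?subr_gt0 // ltr_pdivrMr // mul1r.
by rewrite andbT; lra.
Qed.

Lemma roof_crossingK c : on_roof c -> on_open_side c -> roof_crossing (section_coord c) = c.
Proof.
have q1 := d1; have q2 := d2; have q0 := d0.
move=> r os; have h := section_coord_range r os.
have rg : regular (section_coord c).
  have [h1 h2] := cut_gt0.
  have wE : width d = d.1 + phi * d.2 + (phi * d.1 + d.2) by rewrite /width; ring.
  split; first by move: h; case: ifP => _ /andP[? ?]; apply/andP; split; lra.
  by apply/eqP; move: h; case: ifP => _ /andP[? ?]; lra.
by have [r' os' e] := roof_crossingP rg; exact: section_coord_inj.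
Qed.

Definition floor_crossing (a : piece) (z : R) : 'I_5 * R :=
  match a with
  | LeftShort => (@Ordinal 5 1 isT, z / d.1)
  | LeftLong | BottomLong => (@Ordinal 5 0 isT, (z - d.1) / (phi * (d.1 + d.2)))
  | BottomShort => (@Ordinal 5 4 isT, (z - phi * (d.1 + d.2) - d.1) / d.2)
  end.

Lemma regular_step a z : lower d a < z < upper d a -> regular (z + translation d a).
Proof.
have q1 := d1; have q2 := d2; have q0 := d0.
move=> za; have [X [eX hX pX]] := golden_multiple d1.
have [Y [eY hY pY]] := golden_multiple d2.
move: za; case: a => /=; rewrite /regular; linearize eX eY pX pY => /andP[h1 h2].
all: split; [apply/andP; split; lra | apply/eqP; lra].
Qed.

Lemma crosses_step a z : lower d a < z < upper d a -> regular z ->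
  crosses (roof_crossing z) (floor_crossing a z) /\
  crosses (floor_crossing a z) (roof_crossing (z + translation d a)).
Proof.
have q1 := d1; have q2 := d2; have q0 := d0.
move=> za rz; have rz' := regular_step za.
have [r os e] := roof_crossingP rz; have [r' os' e'] := roof_crossingP rz'.
have pg := phi_gt R; have h3 : 0 < phi * (d.1 + d.2) by rewrite mulr_gt0 // (phi_gt0 R).
have p1 : 0 <= phi * d.1 by rewrite mulr_ge0 // (ltW (phi_gt0 R)).
have p2 : 0 <= phi * d.2 by rewrite mulr_ge0 // (ltW (phi_gt0 R)).
have [wp op e1 e2] : [/\ 0 < side_weight d (floor_crossing a z).1,
    on_open_side (floor_crossing a z),
    coord_P' d (floor_crossing a z).1 (floor_crossing a z).2 = z &
    coord_P d (floor_crossing a z).1 (floor_crossing a z).2 =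
    coord_P d (roof_crossing (z + translation d a)).1 (roof_crossing (z + translation d a)).2].
  have [_ zn'] := rz'.
  have e3 : coord_P d (roof_crossing (z + translation d a)).1 (roof_crossing (z + translation d a)).2 =
      if z + translation d a < d.1 + phi * d.2
      then (phi * d.1 + d.2) + (z + translation d a) else z + translation d a - (d.1 + phi * d.2).
    move: e'; rewrite /section_coord /roof_crossing; case: ifP => _ /= e'; lra.
  rewrite e3; move: za => /andP[].
  case: a {e3 rz' e' r' os'} zn' => /= zn' l u.
  - have x0 : 0 < d.1 by lra.
    split=> //; first by rewrite /on_open_side /= divr_gt0 //= ltr_pdivrMr // mul1r.
      by rewrite divfK // gt_eqF.
    rewrite divfK ?gt_eqF //; case: ltP => h; last by exfalso; lra.
    by ring.
  - split=> //; first by rewrite /on_open_side /= divr_gt0 ?subr_gt0 //= ltr_pdivrMr // mul1r; lra.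
      by rewrite divfK ?gt_eqF // addrC subrK.
    rewrite divfK ?gt_eqF //; case: ltP => h; last by ring.
    by exfalso; lra.
  - have h4 : phi * d.1 + d.1 <= z by lra.
    split=> //; first by rewrite /on_open_side /= divr_gt0 ?subr_gt0 //= ?ltr_pdivrMr // ?mul1r; nra.
      by rewrite divfK ?gt_eqF // addrC subrK.
    rewrite divfK ?gt_eqF //; case: ltP => h; last by exfalso; lra.
    by ring.
  - have y0 : 0 < d.2 by lra.
    split=> //; first by rewrite /on_open_side /= divr_gt0 ?subr_gt0 //= ?ltr_pdivrMr // ?mul1r; lra.
      by rewrite divfK ?gt_eqF //; ring.
    rewrite divfK ?gt_eqF //; case: ltP => h; last by ring.
    by exfalso; lra.
rewrite -side_weight_roof in r; rewrite -side_weight_roof in r'.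
split; first by apply: (crosses_intro_P' aD kap0) => //; rewrite e1.
exact: (crosses_intro_P aD kap0).
Qed.
End Coding.

(** * Closed trajectories and strips *)
Section ClosedTrajectories.
Variable R : realType.
Local Notation phi := (@phi R).
Variables (d : R * R) (kap : R) (theta : R).
Hypotheses (aD : aligned d kap (cos theta, sin theta)) (kap0 : 0 < kap).
Hypotheses (d1 : 0 <= d.1) (d2 : 0 <= d.2) (d0 : 0 < d.1 + d.2).
Local Notation Z := (section_coord d).
Local Notation next := (fun c c' => `[< next_crossing theta c c' >]).

Lemma path_roof (c : 'I_5 * R) (l : seq ('I_5 * R)) : path next c l -> on_roof (last c l) = on_roof c (+) odd (size l).
Proof.
elim: l c => [|c' l IH] c /=; first by rewrite addbF.
case/andP=> /asboolP k /IH ->; rewrite (crosses_roof aD kap0 d1 d2 d0 k).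
by rewrite addNb addbN.
Qed.

Lemma path_coding (c : 'I_5 * R) (l : seq ('I_5 * R)) : path next c l -> on_roof c -> on_roof (last c l) ->
  exists2 w, size l = (size w).*2 & inner_itinerary d (Z c) w (Z (last c l)).
Proof.
have [n] := ubnP (size l); elim: n l c => // n IH [|c' [|c'' l]] c hn.
- by move=> _ _ _; exists [::].
- by move=> /path_roof /= -> ->.
rewrite [path _ _ _]/= => /and3P[/asboolP k /asboolP k' pl] r r'.
have rc : on_roof c''.
  by rewrite (crosses_roof aD kap0 d1 d2 d0 k') (crosses_roof aD kap0 d1 d2 d0 k) negbK.
have [|w sw iw] := IH l c'' _ pl rc r'; first by move: hn => /=; lia.
have [a ha ea] := crosses_twice aD kap0 d1 d2 d0 r k k'.
by exists (a :: w); rewrite /= ?sw // -ea.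
Qed.

Lemma closed_trajectory_roof s : closed_trajectory theta s -> exists2 c, c \in s & on_roof c.
Proof.
case; case: s => // c s _ /andP[cy _].
have [r|r] := boolP (on_roof c); first by exists c => //; rewrite mem_head.
case: s cy => [|c' s] /= /andP[/asboolP k _].
  by have := crosses_roof aD kap0 d1 d2 d0 k; case: (on_roof c).
exists c'; first by rewrite !inE eqxx orbT.
by rewrite (crosses_roof aD kap0 d1 d2 d0 k).
Qed.

Lemma closed_trajectory_rot s (c : 'I_5 * R) : closed_trajectory theta s -> c \in s ->
  exists l : seq ('I_5 * R), [/\ s =i c :: l, size s = (size l).+1, uniq (c :: l) & path next c (rcons l c)].
Proof.
case=> _ /andP[cy us] cs; have [i l e] := rot_to cs.
exists l; split.
- by move=> x; rewrite -(mem_rot i) e.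
- by rewrite -(size_rot i) e.
- by rewrite -e rot_uniq.
- by move: cy; rewrite -(rot_cycle i) e.
Qed.

Lemma closed_trajectory_open s c : closed_trajectory theta s -> c \in s -> on_open_side c.
Proof.
move=> cl cs; have [l [_ _ _ pl]] := closed_trajectory_rot cl cs.
by move: pl; case: l => [|c' l] /= /andP[/asboolP [h _ _ _]].
Qed.

(** Crossings in a closed trajectory are pairwise distinct, so that the
    periodic orbit of the transversal is run through only once; its points are
    all met by the trajectory. *)
Lemma closed_coding s (c : 'I_5 * R) : closed_trajectory theta s -> c \in s -> on_roof c ->
  exists w, [/\ minimal_loop d (Z c) w, size s = (size w).*2 &
    forall z v, itinerary d (Z c) v z -> exists c', [/\ c' \in s, on_roof c' & Z c' = z]].
Proof.
move=> cl cs r; have [l [ms ss ul pl]] := closed_trajectory_rot cl cs.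
have [|w sw iw] := path_coding pl r; first by rewrite last_rcons.
rewrite size_rcons in sw; rewrite last_rcons in iw.
have itw := inner_itineraryW iw.
have w0 : (0 < size w)%N by rewrite -double_gt0 -sw.
(* Roof crossings are the ones at even positions. *)
have E m : (m < size w)%N -> exists c' v', [/\ c' = nth c (c :: l) m.*2, on_roof c', size v' = m &
    itinerary d (Z c) v' (Z c')].
  move=> hm; set l1 := take m.*2 l.
  have s1 : size l1 = m.*2 by rewrite size_takel // -ltnS sw ltn_double.
  have p1 : path next c l1.
    by move: pl; rewrite -cats1 cat_path => /andP[]; rewrite -{1}(cat_take_drop m.*2 l) cat_path => /andP[].
  have r1 : on_roof (last c l1) by rewrite (path_roof p1) s1 odd_double addbF.
  have [v sv iv] := path_coding p1 r r1.
  exists (last c l1), v; split=> //; last exact: inner_itineraryW.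
    rewrite (last_nth c) s1.
    by rewrite /l1; case: (m.*2) => [|k] //=; rewrite nth_take.
  by apply: double_inj; rewrite -sv s1.
have mw : minimal_loop d (Z c) w.
  split=> // v itv v0; rewrite leqNgt; apply/negP => hv.
  have [c' [v' [ec rc sv it']]] := E _ hv.
  have zz : Z c = Z c' by apply: (itinerary_det d1 d2 itv it').
  have cs' : c' \in s by rewrite ms ec mem_nth //= sw ltn_double.
  have cc : c' = c.
    apply: (@section_coord_inj R d d1 d2 d0) => //; try exact: closed_trajectory_open cl _.
  have : index c (c :: l) = (size v).*2 by rewrite -{1}cc ec index_uniq //= sw ltn_double.
  by rewrite /= eqxx; case: (size v) v0.
exists w; split=> //; first by rewrite ss sw.
move=> z v; have [n] := ubnP (size v); elim: n v => // n IH v hn it.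
have [h|h] := leqP (size w) (size v).
  have [v3 ev it3] := itinerary_prefix d1 d2 itw it h.
  apply: (IH v3 _ it3); rewrite -ltnS (leq_trans _ hn) // ltnS ev size_cat.
  by rewrite -[X in (X < _)%N]add0n ltn_add2r.
have [c' [v' [ec rc sv it']]] := E _ h.
exists c'; split=> //; first by rewrite ms ec mem_nth //= sw ltn_double.
exact: (itinerary_det d1 d2 it' it).
Qed.

Lemma inner_itinerary_path z w z' : regular d z -> inner_itinerary d z w z' ->
  regular d z' /\ exists l, [/\ path next (roof_crossing d z) l, size l = (size w).*2 &
    last (roof_crossing d z) l = roof_crossing d z'].
Proof.
elim: w z => [|a w IH] z rz /=; first by move=> ->; split=> //; exists [::].
case=> za iw; have [rz' [l [pl sl el]]] := IH _ (regular_step d1 d2 d0 za) iw.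
split=> //; have [k1 k2] := crosses_step aD kap0 d1 d2 d0 za rz.
exists [:: floor_crossing d a z, roof_crossing d (z + translation d a) & l].
rewrite /= pl andbT sl; split=> //.
by apply/andP; split; apply/asboolP.
Qed.

Lemma inner_itinerary_regular z w z' : (0 < size w)%N -> inner_itinerary d z w z' -> regular d z'.
Proof.
case: w => // a w _ /= [za iw].
by have [] := inner_itinerary_path (regular_step d1 d2 d0 za) iw.
Qed.

(** The path of crossings over the loop may run several times; removing its
    detours leaves a simple cycle. *)
Lemma loop_periodic z w : (0 < size w)%N -> inner_itinerary d z w z -> regular d z /\ Defs.periodic theta (roof_crossing d z).
Proof.
move=> w0 iw; have rz := inner_itinerary_regular w0 iw; split=> //.
have [_ [l [pl sl el]]] := inner_itinerary_path rz iw.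
set c := roof_crossing d z in pl el *.
case/lastP: l pl sl el => [|l c'] pl sl el; first by move: sl => /=; lia.
rewrite last_rcons in el; rewrite el rcons_path in pl.
case/andP: pl => pl kl; case: (shortenP pl) kl => l' pl' ul' _ kl.
exists (c :: l'); last by rewrite mem_head.
by split=> //; rewrite /ucycle /= rcons_path pl'; apply/andP; split.
Qed.

(** The points of the transversal between the two crossings are in the base of
    the tower, hence periodic.  The base does not contain the vertex between the
    sides 2 and 3 in its interior, because that vertex would be regular as an
    image of an inner point of an interval. *)
Lemma tower_connected p q w c1 c2 s1 s2 : (0 < size w)%N -> tower d p q w ->
  closed_trajectory theta s1 -> closed_trajectory theta s2 ->
  c1 \in s1 -> c2 \in s2 -> on_roof c1 -> on_roof c2 ->
  p <= Z c1 < q -> p <= Z c2 < q -> strip_move theta c1 c2.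
Proof.
move=> w0 tw cl1 cl2 m1 m2 r1 r2 h1 h2.
have [g1 g2] := cut_gt0 d1 d2 d0.
have os1 := closed_trajectory_open cl1 m1; have os2 := closed_trajectory_open cl2 m2.
have inJ z : p < z < q -> regular d z /\ Defs.periodic theta (roof_crossing d z).
  move=> /andP[pz zq]; apply: (loop_periodic w0).
  apply: (itinerary_inner (p := p) (p' := p)) => //; apply: tw; lra.
have range1 := section_coord_range d1 d2 d0 r1 os1.
have range2 := section_coord_range d1 d2 d0 r2 os2.
have notcut : ~ (p < d.1 + phi * d.2 < q) by move=> /inJ[[_ /eqP]].
have vv : val c1.1 = val c2.1.
  move: range1 range2; case: eqP => e1 /andP[? ?]; case: eqP => e2 /andP[? ?].
  - by rewrite e1 e2.
  - by exfalso; apply: notcut; lra.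
  - by exfalso; apply: notcut; lra.
  - by move: r1 r2; rewrite /on_roof (introF eqP e1) (introF eqP e2) /= => /eqP-> /eqP->.
right; split; first exact: val_inj.
move=> t ht.
have [e|n1] := eqVneq t c1.2; first by rewrite e -surjective_pairing; exists s1.
have [e|n2] := eqVneq t c2.2.
  by rewrite e (val_inj vv) -surjective_pairing; exists s2.
have ht' : c1.2 < t < c2.2 \/ c2.2 < t < c1.2.
  move: ht; rewrite minElt maxElt; case: ltP => h /andP[a1 a2]; [left|right];
    by rewrite !lt_neqAle a1 a2 ?(eq_sym c1.2) ?(eq_sym c2.2) ?n1 ?n2.
set c : 'I_5 * R := (c1.1, t).
have [hz os] : p < Z c < q /\ on_open_side c.
  move: os1 os2 h1 h2 r1; rewrite /on_open_side /on_roof /section_coord /c /=.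
  rewrite -(vv : nat_of_ord c1.1 = nat_of_ord c2.1) -[val _]/(nat_of_ord c1.1).
  move=> /andP[? ?] /andP[? ?].
  case: (nat_of_ord c1.1) => [|[|[|[|j]]]] //= /andP[? ?] /andP[? ?] _.
  - split; last by case: ht' => /andP[? ?]; apply/andP; split; lra.
    by case: ht' => /andP[? ?]; apply/andP; split; nra.
  - split; last by case: ht' => /andP[? ?]; apply/andP; split; lra.
    by case: ht' => /andP[? ?]; apply/andP; split; nra.
have rc : on_roof c by [].
by have [_] := inJ _ hz; rewrite (roof_crossingK d1 d2 d0 rc os).
Qed.
End ClosedTrajectories.

(** * Period pairs from towers *)
Section Opposite.
Variables (R : realType) (t1 t2 : R).
Hypotheses (ct : cos t2 = - cos t1) (st : sin t2 = - sin t1).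

Lemma next_crossing_opposite c c' : next_crossing t1 c c' <-> next_crossing t2 c' c.
Proof.
split=> -[h1 h2 h3 [copy [l l0 e]]]; (split=> //; first by rewrite eq_sym);
  exists copy, l => //; rewrite -opprB e -scalerN; congr (_ *: _); rewrite ?ct ?st //.
by congr pair; rewrite /= ?ct ?st opprK.
Qed.

Lemma closed_trajectory_opposite s : closed_trajectory t1 s -> closed_trajectory t2 (rev s).
Proof.
case=> s0 /andP[cy us]; split; first by case: s s0 {cy us} => // a s _ /(congr1 size); rewrite size_rev.
apply/andP; split; last by rewrite rev_uniq.
rewrite rev_cycle; move: cy; congr is_true; apply: eq_cycle => c c'.
by apply/asboolP/asboolP => /next_crossing_opposite.
Qed.

Lemma periodic_opposite c : Defs.periodic t1 c -> Defs.periodic t2 c.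
Proof. by case=> s /closed_trajectory_opposite cl cs; exists (rev s); rewrite ?mem_rev. Qed.

Lemma strip_move_opposite c c' : clos_refl_sym_trans _ (strip_move t1) c c' ->
  clos_refl_sym_trans _ (strip_move t2) c c'.
Proof.
elim=> {c c'} [c c' [k|[e k]]|c|c c' _|a b c _ h1 _ h2].
- by apply: rst_sym; apply: rst_step; left; apply/next_crossing_opposite.
- by apply: rst_step; right; split=> // t ht; exact: periodic_opposite (k t ht).
- exact: rst_refl.
- exact: rst_sym.
- exact: rst_trans h1 h2.
Qed.
End Opposite.

Section Strips.
Variable R : realType.
Local Notation phi := (@phi R).
Local Open Scope classical_set_scope.

Lemma strip_opposite (t1 t2 : R) (ct : cos t2 = - cos t1) (st : sin t2 = - sin t1) S :
  strip t1 S -> strip t2 S.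
Proof.
case=> c pc ->; exists c; first exact: periodic_opposite pc.
apply/seteqP; split=> c' /=; apply: strip_move_opposite => //.
  by rewrite ct opprK.
by rewrite st opprK.
Qed.

(** A direction is given modulo 180 degrees, and reversing all trajectories keeps
    strips and periods. *)
Lemma period_pair_upward kind (x : R) b B : period_pair kind x b B ->
  (b <= B)%N /\
  exists2 theta : R, direction_point theta = Some x /\ 0 < sin theta &
  exists S1 S2 : set ('I_5 * R),
    [/\ S1 <> S2, forall S, strip theta S <-> S = S1 \/ S = S2,
        strip_period kind theta S1 b & strip_period kind theta S2 B].
Proof.
case=> bB [t1 dt [S1 [S2 [ne st p1 p2]]]]; split=> //.
have [s0|s0|s0] := ltgtP 0 (sin t1); last by move: dt; rewrite /direction_point -s0 eqxx.
  by exists t1 => //; exists S1, S2.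
have ct : cos (t1 + pi) = - cos t1 by rewrite cosDpi.
have si : sin (t1 + pi) = - sin t1 by rewrite sinDpi.
have ct' : cos t1 = - cos (t1 + pi) by rewrite cosDpi opprK.
have si' : sin t1 = - sin (t1 + pi) by rewrite sinDpi opprK.
exists (t1 + pi).
  by rewrite -dt /direction_point si ct oppr_eq0 invrN mulrNN oppr_gt0.
exists S1, S2; split=> //.
- move=> S; rewrite -st; split; exact: strip_opposite.
- case: p1 => s [cl ins sz]; exists (rev s); split.
  + exact: closed_trajectory_opposite cl.
  + by move=> c; rewrite mem_rev; exact: ins.
  + by rewrite size_map size_rev -sz size_map.
- case: p2 => s [cl ins sz]; exists (rev s); split.
  + exact: closed_trajectory_opposite cl.
  + by move=> c; rewrite mem_rev; exact: ins.
  + by rewrite size_map size_rev -sz size_map.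
Qed.

(** The boundary point of the direction with sector coordinates p. *)
Definition chart (p : R * R) : R := (1 - phi / 2) * ((p.1 - p.2) / (p.1 + p.2)).

(** Both sides are projective coordinates of the direction; that they agree
    amounts to (1 - phi / 2) tan 72 = sin 36. *)
Lemma direction_aligned theta (p : R * R) : 0 < p.1 + p.2 -> 0 < sin theta ->
  direction_point theta = Some (chart p) ->
  aligned p (sin theta / (phi * (p.1 + p.2))) (cos theta, sin theta).
Proof.
move=> p0 s0; rewrite /direction_point gt_eqF // sin_pi5 => -[].
have pg := phi_gt0 R; have pp := phi_sq R.
rewrite /chart /aligned /=; move: (cos theta) (sin theta) s0 (sin72 R) => c s s0 S e.
split; first by rewrite divfK // gt_eqF // mulr_gt0.
have e1 : (phi - 1) * S * c * (p.1 + p.2) = - ((1 - phi / 2) * (p.1 - p.2) * s).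
  have -> : (phi - 1) * S * c * (p.1 + p.2) = - (- ((phi - 1) * S) * (c / s)) * (s * (p.1 + p.2)).
    by field; rewrite gt_eqF.
  by rewrite e; field; rewrite gt_eqF.
apply: (mulIf (x := phi * (p.1 + p.2))); first by rewrite gt_eqF // mulr_gt0.
transitivity (s * (p.2 - p.1)); last by field; rewrite !gt_eqF.
have -> : 2 * S * c * (phi * (p.1 + p.2)) =
    2 * (phi * phi) * ((phi - 1) * S * c * (p.1 + p.2)) 
    - 2 * (phi * phi - phi - 1) * phi * (S * c * (p.1 + p.2)) by ring.
rewrite e1 pp.
have -> : phi + 1 - phi - 1 = 0 by ring.
have : (phi * phi) * (p.1 - p.2) * s = (phi + 1) * (p.1 - p.2) * s by rewrite pp.
lra.
Qed.

Lemma holonomy_neq0 w : indivisible (holonomy w) -> (0 < size w)%N.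
Proof.
case: w => // prim; have : 0%N = 1%N by apply: (prim _ 0); rewrite /holonomy big_nil mul0rn.
by [].
Qed.

(** Each closed trajectory belongs to one of the towers and then has its period.
    The two strips cannot belong to the same tower, by connectedness, so they
    are in different ones and the order b <= B tells which is which. *)
Lemma period_pair_two_towers kind h (p : R * R) b B :
  0 <= p.1 -> 0 <= p.2 -> 0 < p.1 + p.2 ->
  two_towers p h (gvphi h) -> indivisible h -> roman_count h <= roman_count (gvphi h) ->
  period_pair kind (chart p) b B ->
  (arabic_length kind b)%:Z = roman_count h *+ 2 /\
  (arabic_length kind B)%:Z = roman_count (gvphi h) *+ 2.
Proof.
move=> g1 g2 g0 tt prim hle /period_pair_upward[bB [theta [dt s0] [S1 [S2 [ne st P1 P2]]]]].
have aD := direction_aligned g0 s0 dt; set kap := (X in aligned _ X) in aD.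
have kap0 : 0 < kap by rewrite divr_gt0 // mulr_gt0 // phi_gt0.
have [p1 [q1 [w1 [p2 [q2 [w2 [[t1 e1] [t2 e2] cov]]]]]]] := tt.
have n1 : (0 < size w1)%N by apply: holonomy_neq0; rewrite e1.
have n2 : (0 < size w2)%N by apply: holonomy_neq0; rewrite e2; exact: indivisible_phi.
have type s : closed_trajectory theta s ->
    ((size s)%:Z = roman_count h *+ 2 /\
      exists c, [/\ c \in s, on_roof c & p1 <= section_coord p c < q1]) \/
    ((size s)%:Z = roman_count (gvphi h) *+ 2 /\
      exists c, [/\ c \in s, on_roof c & p2 <= section_coord p c < q2]).
  move=> cl; have [c cs r] := closed_trajectory_roof aD kap0 g1 g2 g0 cl.
  have [w [mw sw orb]] := closed_coding aD kap0 g1 g2 g0 cl cs r.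
  have os := closed_trajectory_open cl cs.
  have zr : 0 <= section_coord p c < width p.
    have [h1 h2] := cut_gt0 g1 g2 g0.
    have wE : width p = p.1 + phi * p.2 + (phi * p.1 + p.2) by rewrite /width; ring.
    by have := section_coord_range g1 g2 g0 r os; case: ifP => _ /andP[? ?]; apply/andP; split; lra.
  have [z0 [v [hz itv]]] := cov _ zr.
  rewrite sw -addnn PoszD size_holonomy -mulr2n.
  case: hz => hz; [left|right].
    rewrite -{1}e1 in prim.
    have [-> [v' itv']] := minimal_loop_holonomy g1 g2 t1 n1 hz itv prim mw.
    have [c' [cs' rc' ec']] := orb _ _ itv'.
    by rewrite e1; split=> //; exists c'; rewrite ec'.
  have prim2 : indivisible (holonomy w2) by rewrite e2; exact: indivisible_phi.
  have [-> [v' itv']] := minimal_loop_holonomy g1 g2 t2 n2 hz itv prim2 mw.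
  have [c' [cs' rc' ec']] := orb _ _ itv'.
  by rewrite e2; split=> //; exists c'; rewrite ec'.
have joined : forall c1 c2, S1 c1 -> S2 c2 -> ~ strip_move theta c1 c2.
  move=> c1 c2 h1 h2 k; apply: ne.
  have [a1 _ E1] : strip theta S1 by apply/st; left.
  have [a2 _ E2] : strip theta S2 by apply/st; right.
  move: h1 h2; rewrite E1 E2 /= => h1 h2.
  have a12 : clos_refl_sym_trans _ (strip_move theta) a1 a2.
    apply: rst_trans h1 _; apply: rst_trans (rst_step _ _ _ _ k) _; exact: rst_sym.
  apply/seteqP; split=> c /= hc; last exact: rst_trans a12 hc.
  by apply: rst_trans hc; exact: rst_sym.
case: P1 => s1 [cl1 in1]; case: P2 => s2 [cl2 in2]; rewrite !size_map => z2 z1.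
case: (type _ cl1) => [] [m1 [c1 [cs1 r1 h1]]]; case: (type _ cl2) => [] [m2 [c2 [cs2 r2 h2]]].
- exfalso; apply: (joined c1 c2); [exact: in1|exact: in2|].
  exact: (tower_connected aD kap0 g1 g2 g0 n1 t1 cl1 cl2).
- by rewrite -z1 -z2.
(* The first strip would be the tower of the longer trajectories, hence
   both periods are equal. *)
- have bB' : (arabic_length kind b <= arabic_length kind B)%N by rewrite /arabic_length; case: kind {z1 z2} => //; rewrite leq_double.
  have eq : roman_count h = roman_count (gvphi h).
    apply/eqP; rewrite eq_le hle /=.
    have : (size s1)%:Z <= (size s2)%:Z by rewrite z1 z2.
    by rewrite m1 m2 lerMn2r.
  by rewrite -z1 -z2 m1 m2 eq.
- exfalso; apply: (joined c1 c2); [exact: in1|exact: in2|].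
  exact: (tower_connected aD kap0 g1 g2 g0 n2 t2 cl1 cl2).
Qed.
End Strips.

(** * Cones of words *)
Section Cones.
Variable R : realType.
Local Notation phi := (@phi R).
Implicit Types (p q : R * R) (w : seq 'I_4) (m : 'I_4).

Definition ray_u : R * R := (1, 0).
Definition ray_v : R * R := (0, 1).

Definition comb (a b : R) (c d : R * R) : R * R :=
  (a * c.1 + b * d.1, a * c.2 + b * d.2).

Lemma rword_comb w a b c d : rword w (comb a b c d) = comb a b (rword w c) (rword w d).
Proof.
elim: w => //= m w IH; rewrite /rword /= -!/(rword w _) IH.
by case: m => [[|[|[|[|//]]]] lt_m]; rewrite /sector_map /comb /=; congr pair; ring.
Qed.

Lemma comb_uv p : comb p.1 p.2 ray_u ray_v = p.
Proof. by case: p => x y; rewrite /comb /=; congr pair; ring. Qed.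

Definition rsector_inv m p : R * R :=
  match val m with
  | 0%N => (p.1 - phi * p.2, p.2)
  | 1%N => (phi * p.1 - phi * p.2, phi * p.2 - p.1)
  | 2%N => (phi * p.1 - p.2, phi * p.2 - phi * p.1)
  | _ => (p.1, p.2 - phi * p.1)
  end.

Lemma rsectorK m : cancel (@rsector R m) (rsector_inv m).
Proof.
case=> x y; have pp := phi_sq R.
have px : phi * phi * x = (phi + 1) * x by rewrite pp.
have py : phi * phi * y = (phi + 1) * y by rewrite pp.
by case: m => [[|[|[|[|//]]]] lt_m]; rewrite /rsector /sector_map /rsector_inv /=;
  congr pair; lra.
Qed.

Lemma rword_inj w : injective (@rword R w).
Proof. by elim: w => //= m w IH p q /(can_inj (rsectorK m))/IH. Qed.

(** The four cones of the subdivision have disjoint interiors. *)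
Lemma rsector_disjoint m m' p q : 0 < p.1 -> 0 < p.2 -> 0 <= q.1 -> 0 <= q.2 ->
  rsector m p = rsector m' q -> m = m'.
Proof.
case: p q => x y [x' y'] /= x0 y0 x0' y0'.
have [X [eX hX pX]] := golden_multiple (ltW x0); have [Y [eY hY pY]] := golden_multiple (ltW y0).
have [X' [eX' hX' pX']] := golden_multiple x0'; have [Y' [eY' hY' pY']] := golden_multiple y0'.
case: m m' => [[|[|[|[|//]]]] lt_m] [[|[|[|[|//]]]] lt_m'];
  rewrite /rsector /sector_map /= => -[]; rewrite ?mulrDr ?eX ?eY ?eX' ?eY' => e1 e2;
  have := congr1 ( *%R phi) e1; have := congr1 ( *%R phi) e2;
  rewrite ?mulrDr ?eX ?eY ?eX' ?eY' ?pX ?pY ?pX' ?pY' => f2 f1.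
all: try exact: val_inj.
all: exfalso; lra.
Qed.

Lemma rsector_sum m p : 0 <= p.1 -> 0 <= p.2 ->
  p.1 + p.2 <= (rsector m p).1 + (rsector m p).2.
Proof.
case: p => x y /= x0 y0.
have [X [eX hX pX]] := golden_multiple x0; have [Y [eY hY pY]] := golden_multiple y0.
by case: m => [[|[|[|[|//]]]] lt_m]; rewrite /rsector /sector_map /= ?mulrDr ?eX ?eY; lra.
Qed.

Lemma rword_sum w p : 0 <= p.1 -> 0 <= p.2 ->
  p.1 + p.2 <= (rword w p).1 + (rword w p).2.
Proof.
move=> p1 p2; elim: w => //= m w IH; apply: (le_trans IH).
by have [h1 h2] := rword_ge0 w p1 p2; exact: rsector_sum.
Qed.

Lemma rword_gt0 w p : 0 < p.1 -> 0 < p.2 -> 0 < (rword w p).1 /\ 0 < (rword w p).2.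
Proof.
move=> p1 p2; elim: w => //= m w [h1 h2]; have pp := phi_gt0 R.
rewrite /rword /= -/(rword w p); move: (rword w p) h1 h2 => [x y] /= h1 h2.
have k1 : 0 < phi * x by exact: mulr_gt0.
have k2 : 0 < phi * y by exact: mulr_gt0.
by case: m => [[|[|[|[|//]]]] lt_m]; rewrite /sector_map /=; lra.
Qed.

(** Read the words from the left: an inner point of a cone determines the first
    letter, and the matrices are injective. *)
Lemma cone_disjoint w w' p q : size w = size w' -> 0 < p.1 -> 0 < p.2 ->
  0 <= q.1 -> 0 <= q.2 -> rword w p = rword w' q -> w = w' /\ p = q.
Proof.
elim: w w' => [|m w IH] [|m' w'] //= [sw] p1 p2 q1 q2 e.
have [g1 g2] := rword_gt0 w p1 p2; have [k1 k2] := rword_ge0 w' q1 q2.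
have em : m = m' by exact: rsector_disjoint e.
rewrite -em in e *; have := can_inj (rsectorK m) e.
by move=> /(IH _ sw p1 p2 q1 q2)[-> ->].
Qed.

Lemma cone_prefix w w' p q : (size w <= size w')%N -> 0 < p.1 -> 0 < p.2 ->
  0 <= q.1 -> 0 <= q.2 -> rword w p = rword w' q ->
  exists w2, w' = w ++ w2 /\ p = rword w2 q.
Proof.
move=> sw p1 p2 q1 q2 e; exists (drop (size w) w').
have [h1 h2] := rword_ge0 (drop (size w) w') q1 q2.
have [] := @cone_disjoint w (take (size w) w') p (rword (drop (size w) w') q) => //.
- by rewrite size_takel.
- by rewrite /rword -word_map_cat cat_take_drop.
by move=> ew ep; split=> //; rewrite {1}ew cat_take_drop.
Qed.

Lemma wedge_rword w p q : wedge (rword w p) (rword w q) = wedge p q.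
Proof.
elim: w => //= m w <-; rewrite /rword /= -!/(rword w _).
move: (rword w p) (rword w q) => [x y] [x' y']; have pp := phi_sq R.
have e1 : phi * phi * x * y' = (phi + 1) * x * y' by rewrite pp.
have e2 : phi * phi * x' * y = (phi + 1) * x' * y by rewrite pp.
by case: m => [[|[|[|[|//]]]] lt_m]; rewrite /wedge /sector_map /=; lra.
Qed.

(** Each cone of the subdivision misses one of the two axes, so only the whole
    quadrant has both its sides on the axes. *)
Lemma axes_word w : let c := rword w ray_u in let d := rword w ray_v in
  c.1 * c.2 = 0 -> d.1 * d.2 = 0 -> w = [::].
Proof.
case: w => // m w /=.
have h := wedge_rword (m :: w) ray_u ray_v.
have [u1 u2] : 0 <= ray_u.1 /\ 0 <= ray_u.2 by split=> //=; exact: ler01.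
have [v1 v2] : 0 <= ray_v.1 /\ 0 <= ray_v.2 by split=> //=; exact: ler01.
have [k1 k2] := rword_ge0 w u1 u2; have [k1' k2'] := rword_ge0 w v1 v2.
have := rword_sum w u1 u2; have := rword_sum w v1 v2.
move: h; rewrite /rword /= -!/(rword w _).
move: (rword w ray_u) (rword w ray_v) k1 k2 k1' k2' => [x y] [x' y'] /= x0 y0 x0' y0'.
rewrite /wedge /= !(mulr0, mulr1, subr0, addr0, add0r).
have [X [eX hX pX]] := golden_multiple x0; have [Y [eY hY pY]] := golden_multiple y0.
have [X' [eX' hX' pX']] := golden_multiple x0'; have [Y' [eY' hY' pY']] := golden_multiple y0'.
case: m => [[|[|[|[|//]]]] lt_m]; rewrite /sector_map /= ?eX ?eY ?eX' ?eY' => h s1 s2.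
- move=> /eqP; rewrite mulf_eq0 => /orP[]/eqP e1; first by exfalso; lra.
  move=> /eqP; rewrite mulf_eq0 => /orP[]/eqP e2; first by exfalso; lra.
  by exfalso; move: h; rewrite e1 e2; lra.
- by move=> /eqP; rewrite mulf_eq0 => /orP[]/eqP e1; exfalso; lra.
- by move=> /eqP; rewrite mulf_eq0 => /orP[]/eqP e1; exfalso; lra.
- move=> /eqP; rewrite mulf_eq0 => /orP[]/eqP e1; last by exfalso; lra.
  move=> /eqP; rewrite mulf_eq0 => /orP[]/eqP e2; last by exfalso; lra.
  by exfalso; move: h; rewrite e1 e2; lra.
Qed.
End Cones.

(** * Ideal pentagons in homogeneous coordinates *)
Section Boundary.
Variable R : realType.
Local Notation phi := (@phi R).
Implicit Types (p q : R * R) (w : seq 'I_4) (m : 'I_4).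

Definition pt (p : R * R) : option R :=
  if p.1 + p.2 == 0 then None else Some (chart p).

Lemma pt_Some p : 0 < p.1 + p.2 -> pt p = Some (chart p).
Proof. by move=> h; rewrite /pt gt_eqF. Qed.

Definition homogeneous (g s : R) : option R := if s == 0 then None else Some (g / s).

Lemma ptE p : pt p = homogeneous ((1 - phi / 2) * (p.1 - p.2)) (p.1 + p.2).
Proof. by rewrite /pt /homogeneous /chart mulrA. Qed.

Lemma homogeneous_scale l g s : l != 0 -> homogeneous (l * g) (l * s) = homogeneous g s.
Proof.
move=> l0; rewrite /homogeneous mulf_eq0 (negbTE l0) /=; case: eqP => // /eqP s0.
by congr Some; field; rewrite ?s0 ?l0.
Qed.

Lemma pt_comb_scale l a b c d : l != 0 -> pt (comb (l * a) (l * b) c d) = pt (comb a b c d).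
Proof.
move=> l0; rewrite !ptE -[RHS](homogeneous_scale _ _ l0); congr homogeneous; rewrite /comb /=; ring.
Qed.

Lemma chart_scale_gt0 : 0 < 1 - phi / 2.
Proof. by have := phi_lt R; lra. Qed.

Lemma pt_parallel p q : pt p = pt q -> wedge p q = 0.
Proof.
have a0 := chart_scale_gt0; rewrite /pt /chart /wedge.
case: eqP => [e1|/eqP n1]; case: eqP => [e2|/eqP n2] //.
  have e3 : p.2 = - p.1 by lra.
  have e4 : q.2 = - q.1 by lra.
  by rewrite e3 e4 => _; ring.
case; move/(mulfI (lt0r_neq0 a0)) => e.
have : (p.1 - p.2) * (q.1 + q.2) - (p.1 + p.2) * (q.1 - q.2) = 0.
  have -> : p.1 - p.2 = (q.1 - q.2) / (q.1 + q.2) * (p.1 + p.2) by rewrite -e divfK.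
  by field.
lra.
Qed.

(** The reflection extends to the projective line as the linear involution which
    fixes c and changes the sign of d; the cases are those in which an end of
    the geodesic, the point or its image is at infinity. *)
Lemma reflection_homogeneous (gc sc gd sd p q : R) : gc * sd - sc * gd != 0 ->
  (p != 0) || (q != 0) ->
  reflection (homogeneous gc sc) (homogeneous gd sd)
    (homogeneous (p * gc + q * gd) (p * sc + q * sd)) =
  homogeneous (p * gc - q * gd) (p * sc - q * sd).
Proof.
rewrite {1 2 3}/homogeneous => D pq.
have [sc0|sc0] := eqVneq sc 0.
  have [gc0 sd0] : gc != 0 /\ sd != 0 by move: D; rewrite sc0 mul0r subr0 mulf_eq0 negb_or => /andP.
  rewrite sc0 (negbTE sd0) mulr0 add0r sub0r mulf_eq0 (negbTE sd0) orbF /homogeneous oppr_eq0 mulf_eq0 (negbTE sd0) orbF.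
  have [q0|q0] := eqVneq q 0; first by [].
  by rewrite /=; congr Some; field; rewrite ?q0 ?sd0.
have [sd0|sd0] := eqVneq sd 0.
  rewrite sd0 mulr0 addr0 subr0 mulf_eq0 (negbTE sc0) orbF /homogeneous mulf_eq0 (negbTE sc0) orbF.
  have [p0|p0] := eqVneq p 0; first by [].
  by rewrite /=; congr Some; field; rewrite ?p0 ?sc0.
have [s0|s0] := eqVneq (p * sc + q * sd) 0.
  have p0 : p != 0.
    apply/eqP => p0; move: pq s0; rewrite p0 eqxx /= mul0r add0r => q0 /eqP.
    by rewrite mulf_eq0 (negbTE q0) (negbTE sd0).
  have eq : q = - (p * sc) / sd by apply: (mulIf sd0); rewrite divfK //; lra.
  rewrite /homogeneous ifF; last first.
    apply/negbTE; have -> : p * sc - q * sd = 2 * (p * sc) by lra.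
    by rewrite !mulf_neq0.
  rewrite /= eq; congr Some; field; rewrite sd0 sc0 andbT /= opprK -mulr2n mulrn_eq0 /= mulf_neq0 //.
rewrite /=.
have e1 : (p * gc + q * gd) / (p * sc + q * sd) - (gc / sc + gd / sd) / 2 =
   (gc * sd - sc * gd) * (p * sc - q * sd) / (2 * sc * sd * (p * sc + q * sd)).
  by field; rewrite ?s0 ?sc0 ?sd0.
have [s0'|s0'] := eqVneq (p * sc - q * sd) 0.
  rewrite ifT; last by rewrite -subr_eq0 e1 s0' mulr0 mul0r.
  by rewrite /homogeneous s0' eqxx.
have n1 : (gc * sd - sc * gd) * (p * sc - q * sd) / (2 * sc * sd * (p * sc + q * sd)) != 0.
  by rewrite mulf_neq0 ?invr_neq0 // !mulf_neq0.
rewrite ifF; last by rewrite -subr_eq0 e1 (negbTE n1).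
rewrite /homogeneous (negbTE s0') e1; congr Some.
by field; rewrite ?s0 ?sc0 ?sd0 ?s0' ?D.
Qed.

Lemma reflection_comb c d (p q : R) : wedge c d != 0 -> (p != 0) || (q != 0) ->
  reflection (pt c) (pt d) (pt (comb p q c d)) = pt (comb p (- q) c d).
Proof.
move=> cd pq; have a0 := chart_scale_gt0; rewrite !ptE.
set al := 1 - phi / 2 in a0 *.
have -> : al * ((comb p q c d).1 - (comb p q c d).2) =
    p * (al * (c.1 - c.2)) + q * (al * (d.1 - d.2)) by rewrite /comb /=; ring.
have -> : (comb p q c d).1 + (comb p q c d).2 = p * (c.1 + c.2) + q * (d.1 + d.2).
  by rewrite /comb /=; ring.
rewrite reflection_homogeneous //; first by congr homogeneous; rewrite /comb /=; ring.
have -> : al * (c.1 - c.2) * (d.1 + d.2) - (c.1 + c.2) * (al * (d.1 - d.2)) =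
    (al * 2) * wedge c d by rewrite /wedge; ring.
by rewrite !mulf_neq0 // gt_eqF.
Qed.

Lemma reflectionC a b x : @reflection R a b x = reflection b a x.
Proof.
case: a b x => [a|] [b|] [x|] //=; last by rewrite addrC.
rewrite [b + a]addrC; case: eqP => // _; congr (Some (_ + _ / _)).
by rewrite -sqrrN -mulNr opprB.
Qed.

Definition joined (a b x y : option R) : Prop := (x = a /\ y = b) \/ (x = b /\ y = a).

Lemma joinedC a b x y : joined a b x y <-> joined b a x y.
Proof. by rewrite /joined; tauto. Qed.

Definition cyclic5 (a0 a1 a2 a3 a4 x y : option R) : Prop :=
  joined a0 a1 x y \/ joined a1 a2 x y \/ joined a2 a3 x y \/ joined a3 a4 x y \/
  joined a4 a0 x y.

Lemma cyclic5_map (f : option R -> option R) a0 a1 a2 a3 a4 x y :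
  cyclic5 (f a0) (f a1) (f a2) (f a3) (f a4) x y <->
  exists x' y', [/\ cyclic5 a0 a1 a2 a3 a4 x' y', x = f x' & y = f y'].
Proof.
rewrite /cyclic5 /joined; split.
  case=> [h|[h|[h|[h|h]]]]; case: h => -[-> ->];
    by eexists; eexists; split; try reflexivity; tauto.
by case=> x' [y' [h -> ->]]; case: h => [h|[h|[h|[h|h]]]]; case: h => -[-> ->]; tauto.
Qed.

Lemma is_sideE (p : 5.-tuple (option R)) x y : is_side p x y <->
  cyclic5 (nth None p 0) (nth None p 1) (nth None p 2) (nth None p 3) (nth None p 4) x y.
Proof.
have S (k l : nat) (h : (k < 5)%N) : (k.+1 %% 5)%N = l ->
    tnth p (Ordinal h) = nth None p k /\ tnth p (ordS (Ordinal h)) = nth None p l.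
  by move=> e; rewrite !(tnth_nth None) /= e.
rewrite /cyclic5 /joined; split.
  case=> -[[|[|[|[|[|//]]]]] lt_j].
  - by have [-> ->] := S _ 1%N lt_j erefl; tauto.
  - by have [-> ->] := S _ 2%N lt_j erefl; tauto.
  - by have [-> ->] := S _ 3%N lt_j erefl; tauto.
  - by have [-> ->] := S _ 4%N lt_j erefl; tauto.
  - by have [-> ->] := S _ 0%N lt_j erefl; tauto.
case=> [h|[h|[h|[h|h]]]].
- by exists (@Ordinal 5 0 isT); have [-> ->] := S 0%N 1%N isT erefl; tauto.
- by exists (@Ordinal 5 1 isT); have [-> ->] := S 1%N 2%N isT erefl; tauto.
- by exists (@Ordinal 5 2 isT); have [-> ->] := S 2%N 3%N isT erefl; tauto.
- by exists (@Ordinal 5 3 isT); have [-> ->] := S 3%N 4%N isT erefl; tauto.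
- by exists (@Ordinal 5 4 isT); have [-> ->] := S 4%N 0%N isT erefl; tauto.
Qed.

Lemma is_side_map (f : option R -> option R) (p : 5.-tuple (option R)) x y :
  is_side (map_tuple f p) x y <-> exists x' y', [/\ is_side p x' y', x = f x' & y = f y'].
Proof.
split.
  case=> j; rewrite !tnth_map => -[[-> ->]|[-> ->]].
    by exists (tnth p j), (tnth p (ordS j)); split=> //; exists j; left.
  by exists (tnth p (ordS j)), (tnth p j); split=> //; exists j; right.
case=> x' [y' [[j h] -> ->]]; exists j; rewrite !tnth_map.
by case: h => -[-> ->]; [left|right].
Qed.

(** The regular ideal pentagon with side (c, d) in the cone spanned by c and d. *)
Definition pentagon_side (c d : R * R) : option R -> option R -> Prop :=
  cyclic5 (pt c) (pt (comb phi 1 c d)) (pt (comb phi phi c d)) (pt (comb 1 phi c d)) (pt d).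

Lemma reflected_pentagon c d x y : wedge c d != 0 ->
  pentagon_side c d x y <->
  exists x' y', [/\ pentagon_side c (comb 0 (-1) c d) x' y',
    x = reflection (pt c) (pt d) x' & y = reflection (pt c) (pt d) y'].
Proof.
move=> cd.
have c0 : c = comb 1 0 c d by case: (c) => *; rewrite /comb /=; congr pair; ring.
have d0 : d = comb 0 1 c d by case: (d) => *; rewrite /comb /=; congr pair; ring.
have E a b : comb a b c (comb 0 (-1) c d) = comb a (- b) c d.
  by rewrite /comb /=; congr pair; ring.
have p0 : phi != 0 by rewrite gt_eqF // phi_gt0.
rewrite /pentagon_side !E.
have F (a b : R) : (a != 0) || (b != 0) ->
    reflection (pt c) (pt d) (pt (comb a (- b) c d)) = pt (comb a b c d).
  by move=> h; rewrite reflection_comb ?opprK // oppr_eq0.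
have := F 1 0; rewrite oppr0 -c0 oner_eq0 => /(_ isT) e0.
have := F 0 1; rewrite oner_eq0 orbT -d0 => /(_ isT) e4.
have e1 := F phi 1; have e2 := F phi phi; have e3 := F 1 phi.
rewrite p0 oner_eq0 /= in e1 e2 e3.
rewrite -cyclic5_map e0 e4 (e1 isT) (e2 isT) (e3 isT); tauto.
Qed.

End Boundary.

(** * The tessellation indexed by words *)
Section Tessellation.
Variable R : realType.
Local Notation phi := (@phi R).
Local Notation u := (ray_u R).
Local Notation v := (ray_v R).
Implicit Types (p q c d : R * R) (w : seq 'I_4) (m : 'I_4) (e : bool).

Definition child p c d : R * R := comb p.1 p.2 c d.

Lemma pentagon_sideP c d x y : pentagon_side c d x y <->
  joined (pt c) (pt d) x y \/
  exists m, joined (pt (child (rsector m u) c d)) (pt (child (rsector m v) c d)) x y.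
Proof.
have c0 : c = comb 1 0 c d by case: (c) => *; rewrite /comb /=; congr pair; ring.
have d0 : d = comb 0 1 c d by case: (d) => *; rewrite /comb /=; congr pair; ring.
have J := joinedC (pt d) (pt c) x y.
rewrite /pentagon_side /cyclic5 /child /rsector /sector_map.
split.
- case=> [h|[h|[h|[h|h]]]]; last by left; tauto.
  + by right; exists (@Ordinal 4 0 isT); rewrite /= !(mulr0, mulr1, addr0, add0r) -c0.
  + by right; exists (@Ordinal 4 1 isT); rewrite /= !(mulr0, mulr1, addr0, add0r).
  + by right; exists (@Ordinal 4 2 isT); rewrite /= !(mulr0, mulr1, addr0, add0r).
  + by right; exists (@Ordinal 4 3 isT); rewrite /= !(mulr0, mulr1, addr0, add0r) -d0.
case=> [h|[]]; first by tauto.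
by case=> [[|[|[|[|//]]]] lt_m] /=; rewrite !(mulr0, mulr1, addr0, add0r) -?c0 -?d0; tauto.
Qed.

(** A regular pentagon looks the same from each of its sides.  Seen from the side
    (c', d') it lies outside of the cone of c' and d', that is in the cone of
    c' and - d'. *)
Lemma pentagon_side_child m c d x y :
  let c' := child (rsector m u) c d in let d' := child (rsector m v) c d in
  pentagon_side c d x y <-> pentagon_side c' (comb 0 (-1) c' d') x y.
Proof.
have pp := phi_sq R.
have c0 : c = comb 1 0 c d by case: (c) => *; rewrite /comb /=; congr pair; ring.
have d0 : d = comb 0 1 c d by case: (d) => *; rewrite /comb /=; congr pair; ring.
move=> c' d'; have ec : pt c = pt (comb 1 0 c d) by rewrite -c0.
have ed : pt d = pt (comb 0 1 c d) by rewrite -d0.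
rewrite /pentagon_side ec ed.
have E l A B a b : l != 0 ->
    a * (rsector m u).1 - b * (rsector m v).1 = l * A ->
    a * (rsector m u).2 - b * (rsector m v).2 = l * B ->
    pt (comb a b c' (comb 0 (-1) c' d')) = pt (comb A B c d).
  move=> l0 h1 h2; rewrite -(pt_comb_scale A B c d l0) -h1 -h2; congr pt.
  by rewrite /c' /d' /child /comb /=; congr pair; ring.
have E0 A B : (rsector m u).1 = A -> (rsector m u).2 = B -> pt c' = pt (comb A B c d).
  by move=> <- <-.
have E4 A B : (rsector m v).1 = A -> (rsector m v).2 = B -> pt (comb 0 (-1) c' d') = pt (comb A B c d).
  move=> <- <-; rewrite -(pt_comb_scale _ _ c d (l := -1)) ?oppr_eq0 ?oner_eq0 //.
  by congr pt; rewrite /c' /d' /child /comb /=; congr pair; ring.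
have n1 : -1 != 0 :> R by rewrite oppr_eq0 oner_eq0.
have n2 : 1 != 0 :> R by rewrite oner_eq0.
move: E E0 E4; rewrite {}/c' {}/d' /rsector /sector_map.
case: m => [[|[|[|[|//]]]] lt_m] /= E E0 E4.
- rewrite (E0 1 0) ?(E4 phi 1) ?(E (-1) 0 1 phi 1) ?(E (-1) 1 phi phi phi) ?(E (-1) phi phi 1 phi) //; try by lra.
  by rewrite /cyclic5 /joined; tauto.
- rewrite (E0 phi 1) ?(E4 phi phi) ?(E 1 1 0 phi 1) ?(E (-1) 0 1 phi phi) ?(E (-1) 1 phi 1 phi) //; try by lra.
  by rewrite /cyclic5 /joined; tauto.
- rewrite (E0 phi phi) ?(E4 1 phi) ?(E 1 phi 1 phi 1) ?(E 1 1 0 phi phi) ?(E (-1) 0 1 1 phi) //; try by lra.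
  by rewrite /cyclic5 /joined; tauto.
- rewrite (E0 1 phi) ?(E4 0 1) ?(E 1 phi phi phi 1) ?(E 1 phi 1 phi phi) ?(E 1 1 0 1 phi) //; try by lra.
  by rewrite /cyclic5 /joined; tauto.
Qed.

(** For e = true, the cone of w lies in the third sector.  For e = false, it lies
    in the mirror image of this sector, which represents the rest of the
    boundary: there the empty word stands for the pentagon of generation 0, and
    the words of length 1 for the pentagons across its four other sides. *)
Definition node_vec e w p : R * R :=
  ((rword w p).1, if e then (rword w p).2 else - (rword w p).2).

Definition node_edge e w := joined (pt (node_vec e w u)) (pt (node_vec e w v)).

Definition node_side e w := pentagon_side (node_vec e w u) (node_vec e w v).

Lemma node_vec_rcons e w m p : node_vec e (rcons w m) p =
  child (rsector m p) (node_vec e w u) (node_vec e w v).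
Proof.
rewrite /node_vec /rword word_map_rcons -/(rword w _) -/(rsector m p).
rewrite -{1 2 3}[rsector m p]comb_uv rword_comb.
by case: e; rewrite /child /comb /=; congr pair; ring.
Qed.

Lemma wedge_node e w : wedge (node_vec e w u) (node_vec e w v) != 0.
Proof.
have := wedge_rword w u v; rewrite /wedge /node_vec /= => h.
by case: e; apply/eqP; lra.
Qed.

Lemma node_sideP e w x y : node_side e w x y <->
  node_edge e w x y \/ exists m, node_edge e (rcons w m) x y.
Proof.
rewrite /node_side pentagon_sideP /node_edge.
by split; (case=> [h|[m h]]; [left|right; exists m; move: h; rewrite !node_vec_rcons]).
Qed.

Lemma node_side_reflect e w m x y : node_side e (rcons w m) x y <->
  exists x' y', let f := reflection (pt (node_vec e (rcons w m) u)) (pt (node_vec e (rcons w m) v)) in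
    [/\ node_side e w x' y', x = f x' & y = f y'].
Proof.
rewrite /node_side reflected_pentagon ?wedge_node //.
split=> -[x' [y' [h ex ey]]]; exists x', y'; split=> //; move: h;
  have := pentagon_side_child m (node_vec e w u) (node_vec e w v) x' y';
  cbv zeta; rewrite -!node_vec_rcons; tauto.
Qed.

Lemma node_vec_root_u : node_vec false [::] u = node_vec true [::] u.
Proof. by rewrite /node_vec /= oppr0. Qed.

Lemma node_pt_root_v : pt (node_vec false [::] v) = pt (node_vec true [::] v).
Proof.
rewrite -[node_vec false [::] v](_ : comb (-1 * 0) (-1 * 1) u v = _) ?pt_comb_scale.
- by rewrite (comb_uv (0, 1)).
- by rewrite oppr_eq0 oner_eq0.
- by rewrite /comb /node_vec /=; congr pair; ring.
Qed.

Lemma node_side_reflect_root x y : node_side true [::] x y <->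
  exists x' y', let f := reflection (pt (node_vec true [::] u)) (pt (node_vec true [::] v)) in
    [/\ node_side false [::] x' y', x = f x' & y = f y'].
Proof.
rewrite /node_side reflected_pentagon ?wedge_node // node_vec_root_u.
have -> // : comb 0 (-1) (node_vec true [::] u) (node_vec true [::] v) = node_vec false [::] v.
by rewrite /comb /node_vec /=; congr pair; ring.
Qed.

Lemma node_edge_root x y : node_edge false [::] x y <-> node_edge true [::] x y.
Proof. by rewrite /node_edge node_vec_root_u node_pt_root_v. Qed.

Lemma pentagon0_side x y : is_side (@pentagon0 R) x y <-> node_side false [::] x y.
Proof.
have pp := phi_sq R; have pg := phi_gt R.
rewrite is_sideE /node_side /pentagon_side /node_vec /comb /pt /chart /=.
rewrite !(mulr0, mulr1, addr0, add0r, oppr0, mul1r, subr0, mulrN).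
have a1 : phi - 1 != 0 by apply/eqP; lra.
have a2 : 1 - phi != 0 by apply/eqP; lra.
rewrite oner_eq0 (negbTE a1) subrr eqxx (negbTE a2) oppr_eq0 oner_eq0.
have -> : (1 - phi / 2) / 1 = 1 - phi / 2 by rewrite divr1.
have -> : (1 - phi / 2) * ((phi - -1) / (phi - 1)) = phi / 2.
  apply: (mulIf a1); rewrite mulrA divfK //; lra.
have -> : (1 - phi / 2) * ((1 - - phi) / (1 - phi)) = - (phi / 2).
  apply: (mulIf a2); rewrite mulrA divfK //; lra.
have -> : (1 - phi / 2) * (- -1 / -1) = phi / 2 - 1 by field.
by [].
Qed.
End Tessellation.

(** * Generations of pentagons *)
Section Generations.
Variable R : realType.
Local Notation phi := (@phi R).
Local Notation u := (ray_u R).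
Local Notation v := (ray_v R).
Implicit Types (p q c d : R * R) (x y : option R) (w : seq 'I_4) (m : 'I_4) (e : bool).

Definition quadrant p : Prop := [/\ 0 <= p.1, 0 <= p.2 & 0 < p.1 + p.2].

Lemma quadrant_u : quadrant u. Proof. by split; rewrite /= ?ler01 ?addr0 ?ltr01. Qed.
Lemma quadrant_v : quadrant v. Proof. by split; rewrite /= ?ler01 ?add0r ?ltr01. Qed.

Lemma quadrant_rword w p : quadrant p -> quadrant (rword w p).
Proof.
case=> p1 p2 p0; have [h1 h2] := rword_ge0 w p1 p2.
by split=> //; exact: lt_le_trans p0 (rword_sum w p1 p2).
Qed.

Lemma rword_scale w l p : rword w (l * p.1, l * p.2) = (l * (rword w p).1, l * (rword w p).2).
Proof.
have -> : (l * p.1, l * p.2) = comb l 0 p p by rewrite /comb; congr pair; ring.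
by rewrite rword_comb /comb; congr pair; ring.
Qed.

Lemma parallel_quadrant p q : quadrant p -> quadrant q -> wedge p q = 0 ->
  exists2 l, 0 < l & p = (l * q.1, l * q.2).
Proof.
case=> p1 p2 p0 [q1 q2 q0]; rewrite /wedge => h.
exists ((p.1 + p.2) / (q.1 + q.2)); first exact: divr_gt0.
case: p q p1 p2 p0 q1 q2 q0 h => x y [x' y'] /= *.
by congr pair; rewrite mulrAC; (apply: (mulIf (x := x' + y')); first by rewrite gt_eqF);
  rewrite divfK ?gt_eqF //; lra.
Qed.

Lemma node_pt_eq e w w' p q : quadrant p -> quadrant q ->
  pt (node_vec e w p) = pt (node_vec e w' q) ->
  exists2 l, 0 < l & rword w p = rword w' (l * q.1, l * q.2).
Proof.
move=> hp hq /pt_parallel h.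
have [] := @parallel_quadrant (rword w p) (rword w' q).
- exact: quadrant_rword.
- exact: quadrant_rword.
- by move: h; rewrite /wedge /node_vec /=; case: e; lra.
by move=> l l0 ->; exists l => //; rewrite rword_scale.
Qed.

Lemma node_pt_opposite w w' p q : quadrant p -> quadrant q ->
  pt (node_vec true w p) = pt (node_vec false w' q) ->
  (rword w p).1 * (rword w p).2 = 0 /\ (rword w' q).1 * (rword w' q).2 = 0.
Proof.
move=> hp hq /pt_parallel; rewrite /wedge /node_vec /=.
have [h1 h2 h0] := quadrant_rword w hp; have [k1 k2 k0] := quadrant_rword w' hq.
move: (rword w p) (rword w' q) h1 h2 h0 k1 k2 k0 => [x y] [x' y'] /= x0 y0 s0 x0' y0' s0' h.
have a1 : 0 <= x * y' by exact: mulr_ge0.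
have a2 : 0 <= y * x' by exact: mulr_ge0.
have b1 : x * y' = 0 by lra.
have b2 : y * x' = 0 by lra.
move/eqP: b1; rewrite mulf_eq0 => /orP[]/eqP z1; move/eqP: b2; rewrite mulf_eq0 => /orP[]/eqP z2.
- by exfalso; lra.
- by rewrite z1 z2 !mul0r.
- by rewrite z1 z2 !mulr0.
- by exfalso; lra.
Qed.

Definition same_ends e w e' w' := 
  (pt (node_vec e w u) = pt (node_vec e' w' u) /\ pt (node_vec e w v) = pt (node_vec e' w' v)) \/
  (pt (node_vec e w u) = pt (node_vec e' w' v) /\ pt (node_vec e w v) = pt (node_vec e' w' u)).

(** If the cones agree, the sum of the spanning vectors of one is interior to
    the other one, so that one word extends the other; the extension has its
    cone equal to the quadrant. *)
Lemma same_ends_prefix e w w' : (size w <= size w')%N -> same_ends e w e w' -> w = w'.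
Proof.
move=> sw h; have [qu qv] := (quadrant_u, quadrant_v).
have [a [b [c [d [a0 b0 e1 e2 [E1 E2]]]]]] : exists a b (c d : R * R),
    [/\ 0 < a, 0 < b, rword w u = rword w' (a * c.1, a * c.2),
      rword w v = rword w' (b * d.1, b * d.2) & ((c = u /\ d = v) \/ (c = v /\ d = u))
      /\ True].
  case: h => -[/(node_pt_eq qu)h1 /(node_pt_eq qv)h2].
    have [a a0 e1] := h1 qu; have [b b0 e2] := h2 qv.
    by exists a, b, u, v; split=> //; split=> //; left.
  have [a a0 e1] := h1 qv; have [b b0 e2] := h2 qu.
  by exists a, b, v, u; split=> //; split=> //; right.
have e3 : rword w (1, 1) = rword w' (a * c.1 + b * d.1, a * c.2 + b * d.2).
  rewrite -(comb_uv (1, 1)) rword_comb e1 e2 -rword_comb; congr rword.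
  by rewrite /comb /=; congr pair; ring.
have [||||w2 [ew ep]] := cone_prefix sw _ _ _ _ e3; try exact: ltr01.
- by case: E1 => -[-> ->]; rewrite /= !(mulr0, mulr1, addr0, add0r) ltW.
- by case: E1 => -[-> ->]; rewrite /= !(mulr0, mulr1, addr0, add0r) ltW.
have w20 : w2 = [::].
  have i1 : u = rword w2 (a * c.1, a * c.2).
    by apply: (@rword_inj R w); rewrite e1 ew /rword word_map_cat.
  have i2 : v = rword w2 (b * d.1, b * d.2).
    by apply: (@rword_inj R w); rewrite e2 ew /rword word_map_cat.
  rewrite rword_scale in i1; rewrite rword_scale in i2.
  have j1 : (rword w2 c).1 * (rword w2 c).2 = 0.
    move: (congr1 snd i1) => /= /esym /eqP; rewrite mulf_eq0 (gt_eqF a0) => /eqP ->.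
    by rewrite mulr0.
  have j2 : (rword w2 d).1 * (rword w2 d).2 = 0.
    move: (congr1 fst i2) => /= /esym /eqP; rewrite mulf_eq0 (gt_eqF b0) => /eqP ->.
    by rewrite mul0r.
  by case: E1 => -[ec ed]; rewrite ec in j1; rewrite ed in j2; exact: (@axes_word R w2).
by rewrite ew w20 cats0.
Qed.

Lemma same_ends_sym e w e' w' : same_ends e w e' w' -> same_ends e' w' e w.
Proof. by case=> -[h1 h2]; [left|right]; split. Qed.

(** Distinct words give distinct geodesics, except that the two empty words
    share the side between the pentagon of generation 0 and the third sector. *)
Lemma same_ends_eq e w e' w' : same_ends e w e' w' ->
  (e = e' /\ w = w') \/ (w = [::] /\ w' = [::]).
Proof.
have [qu qv] := (quadrant_u, quadrant_v).
have O w1 w2 : same_ends true w1 false w2 -> w1 = [::] /\ w2 = [::].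
  move=> h; have [h1 h2 h3 h4] : [/\ (rword w1 u).1 * (rword w1 u).2 = 0,
     (rword w1 v).1 * (rword w1 v).2 = 0,
     (rword w2 u).1 * (rword w2 u).2 = 0 & (rword w2 v).1 * (rword w2 v).2 = 0].
    case: h => -[h1 h2].
      by have [? ?] := node_pt_opposite qu qu h1; have [? ?] := node_pt_opposite qv qv h2.
    by have [? ?] := node_pt_opposite qu qv h1; have [? ?] := node_pt_opposite qv qu h2.
  by split; [exact: (@axes_word R w1)|exact: (@axes_word R w2)].
have [<-|ne] := eqVneq e e'.
  move=> h; left; split=> //; have [sw|/ltnW sw] := leqP (size w) (size w').
    exact: same_ends_prefix h.
  by apply/esym; apply: same_ends_prefix sw _; apply: same_ends_sym h.
case: e e' ne => -[] // _; first by right; exact: O.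
by move=> /same_ends_sym/O[-> ->]; right.
Qed.

Lemma node_edge_eq e w e' w' x y : node_edge e w x y -> node_edge e' w' x y ->
  (e = e' /\ w = w') \/ (w = [::] /\ w' = [::]).
Proof.
move=> h1 h2; apply: same_ends_eq; move: h1 h2; rewrite /node_edge /joined /same_ends.
by case=> -[<- <-]; case=> -[<- <-]; tauto.
Qed.

Definition node_level e w : nat := if e then (size w).+1 else size w.

Definition represents (p : 5.-tuple (option R)) e w := forall x y, is_side p x y <-> node_side e w x y.

(** The two parts are proved together.  That a pentagon is not reflected back in
    the side through which it was obtained needs the existence of its parent;
    that the reflections in the other sides are allowed needs the description
    of the earlier generations. *)
Lemma generation_node k :
  (forall p : 5.-tuple (option R), generation k p -> exists e w, node_level e w = k /\ represents p e w) /\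
  (forall e w, node_level e w = k -> exists2 p, @generation R k p & represents p e w).
Proof.
have [n] := ubnP k; elim: n k => // n IH [|k] hk.
  split.
    by move=> p /= ->; exists false, [::]; split=> // x y; exact: pentagon0_side.
  case=> // -[] // _; exists pentagon0 => // x y; exact: pentagon0_side.
have [nodeP nodeE] := IH k hk.
have step (p : 5.-tuple (option R)) e w x y e' w' : represents p e w -> node_edge e' w' x y ->
    (forall x y, node_side e' w' x y <->
    exists x' y', let f := reflection (pt (node_vec e' w' u)) (pt (node_vec e' w' v)) in
      [/\ node_side e w x' y', x = f x' & y = f y']) ->
    represents (map_tuple (reflection x y) p) e' w'.
  move=> rp ed hr x1 y1; rewrite is_side_map hr.
  have E z : reflection x y z = reflection (pt (node_vec e' w' u)) (pt (node_vec e' w' v)) z.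
    by case: ed => -[-> ->] //; rewrite reflectionC.
  by split=> -[x' [y' [/rp h -> ->]]]; exists x', y'; split.
have root (p : 5.-tuple (option R)) x y : represents p false [::] -> node_edge true [::] x y ->
    represents (map_tuple (reflection x y) p) true [::].
  move=> rp ed; by apply: (step p false [::]) => // x1 y1; exact: node_side_reflect_root.
split.
  move=> q /= [p [x [y [gp sp -> hk1]]]].
  have [e [w [lw rp]]] := nodeP p gp.
  have /node_sideP[closing|[m child_edge]] := (rp x y).1 sp.
    (* Reflecting in the closing side gives back the parent, except at
       generation 0, where it leads into the third sector. *)
    case: k hk gp hk1 {nodeP nodeE step} lw IH => [|k] hk gp hk1 lw IH.
      rewrite /= in gp *; case: e w lw rp closing => // -[] // _ rp /node_edge_root closing.
      by exists true, [::]; split=> //; exact: root.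
    exfalso.
    have [_ parents] := IH k (ltnW hk).
    case/lastP: w lw rp closing => [|w m] lw rp closing.
      case: e lw rp closing => // -[/= k0] rp closing; rewrite -k0 in hk1 parents.
      have [r gr rr] := parents false [::] erefl.
      by apply: (hk1 r gr); apply/rr/node_sideP; left; apply/node_edge_root.
    have [|r gr rr] := parents e w.
      by move: lw; rewrite /node_level size_rcons; case: (e) => -[].
    by apply: (hk1 r gr); apply/rr/node_sideP; right; exists m.
  exists e, (rcons w m); split; first by move: lw; rewrite /node_level size_rcons; case: (e) => ->.
  by apply: (step p e w) => // x1 y1; exact: node_side_reflect.
move=> e w; case/lastP: w => [|w m] lw.
  case: e lw => // -[lw]; rewrite -lw in hk nodeE *.
  have [p gp rp] := nodeE false [::] erefl.
  exists (map_tuple (reflection (pt (node_vec true [::] u)) (pt (node_vec true [::] v))) p); last first.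
    by apply: root => //; left.
  exists p, (pt (node_vec true [::] u)), (pt (node_vec true [::] v)); split=> //.
  by apply/rp/node_sideP; left; apply/node_edge_root; left.
have lw' : node_level e w = k by move: lw; rewrite /node_level size_rcons; case: e => -[].
have [p gp rp] := nodeE e w lw'.
exists (map_tuple (reflection (pt (node_vec e (rcons w m) u)) (pt (node_vec e (rcons w m) v))) p); last first.
  by apply: (step p e w) => //; [left|move=> x1 y1; exact: node_side_reflect].
exists p, (pt (node_vec e (rcons w m) u)), (pt (node_vec e (rcons w m) v)); split=> //.
  by apply/rp/node_sideP; right; exists m; left.
case: k hk lw {nodeP nodeE step gp lw'} => // k hk lw r gr.
have [nodeP _] := IH k (ltnW hk).
have [e2 [w2 [l2 rr]]] := nodeP r gr.
have self : node_edge e (rcons w m) (pt (node_vec e (rcons w m) u)) (pt (node_vec e (rcons w m) v)) by left.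
move=> /rr/node_sideP[h|[m2 h]].
  case: (node_edge_eq self h) => -[e1 e3]; last by case: (w) e1.
  by move: lw; rewrite e1 e3 l2; lia.
case: (node_edge_eq self h) => -[e1 e3]; last by case: (w) e1.
move: lw; rewrite e1 e3 -l2 /node_level size_rcons; case: (e2); lia.
Qed.
End Generations.

(** * Points adjacent to a vertex *)
Section Adjacency.
Variable R : realType.
Local Notation phi := (@phi R).
Local Notation u := (ray_u R).
Local Notation v := (ray_v R).
Implicit Types (p q c d : R * R) (x y : option R) (w : seq 'I_4) (m : 'I_4) (e : bool).

Lemma rword_cat w1 w2 p : rword (w1 ++ w2) p = rword w1 (rword w2 p).
Proof. exact: word_map_cat. Qed.

Lemma rword_rcons w m p : rword (rcons w m) p = rword w (rsector m p).
Proof. exact: word_map_rcons. Qed.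

Lemma adjacent_node x y : Defs.adjacent x y <-> exists e w, node_edge e w x y.
Proof.
split.
  case=> k [p [gp sp]]; have [/(_ p gp) [e [w [_ rp]]] _] := generation_node R k.
  by have /rp/node_sideP[h|[m h]] := sp; [exists e, w|exists e, (rcons w m)].
case=> e [w h]; have [_ /(_ e w erefl)[p gp rp]] := generation_node R (node_level e w).
by exists (node_level e w), p; split=> //; apply/rp/node_sideP; left.
Qed.

Lemma rsector_u_axis m p l : 0 < l -> quadrant p -> (l, 0) = rsector m p ->
  m = ord0 /\ p = (l, 0).
Proof.
case: p => x y l0 [/= x0 y0 s0].
have [X [eX hX pX]] := golden_multiple x0; have [Y [eY hY pY]] := golden_multiple y0.
case: m => [[|[|[|[|//]]]] lt_m]; rewrite /rsector /sector_map /= ?eX ?eY => -[e1 e2].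
- have y00 : y = 0 by lra.
  have Y00 : Y = 0 by lra.
  by split; [exact: val_inj|congr pair; lra].
all: by exfalso; lra.
Qed.

Lemma rsector_v_axis m p l : 0 < l -> quadrant p -> (0, l) = rsector m p ->
  m = ord_max /\ p = (0, l).
Proof.
case: p => x y l0 [/= x0 y0 s0].
have [X [eX hX pX]] := golden_multiple x0; have [Y [eY hY pY]] := golden_multiple y0.
case: m => [[|[|[|[|//]]]] lt_m]; rewrite /rsector /sector_map /= ?eX ?eY => -[e1 e2].
1-3: by exfalso; lra.
have x00 : x = 0 by lra.
have X00 : X = 0 by lra.
by split; [exact: val_inj|congr pair; lra].
Qed.

Lemma rword_u_axis w p l : 0 < l -> quadrant p -> (l, 0) = rword w p ->
  w = nseq (size w) ord0 /\ p = (l, 0).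
Proof.
move=> l0 hp; elim: w => [|m w IH] /=; first by move=> ->.
by move/(rsector_u_axis l0 (quadrant_rword w hp)) => [-> /esym/IH[{1}-> ->]].
Qed.

Lemma rword_v_axis w p l : 0 < l -> quadrant p -> (0, l) = rword w p ->
  w = nseq (size w) ord_max /\ p = (0, l).
Proof.
move=> l0 hp; elim: w => [|m w IH] /=; first by move=> ->.
by move/(rsector_v_axis l0 (quadrant_rword w hp)) => [-> /esym/IH[{1}-> ->]].
Qed.

Lemma rsector_inner m : m != ord0 -> 0 < (rsector m u).1 /\ 0 < (rsector m u).2.
Proof.
have pg := phi_gt R.
by case: m => [[|[|[|[|//]]]] lt_m] // _; rewrite /rsector /sector_map /=; split; lra.
Qed.

(** A ray of the subdivision belongs only to the two cones that it separates. *)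
Lemma rsector_boundary m m1 m' p : val m = (val m1).+1 -> quadrant p ->
  rsector m u = rsector m' p -> (m' = m /\ p = u) \/ (m' = m1 /\ p = v).
Proof.
have pg := phi_gt R; have pl := phi_lt R; have pp := phi_sq R.
case: p => x y em [/= x0 y0 s0].
have [X [eX hX pX]] := golden_multiple x0; have [Y [eY hY pY]] := golden_multiple y0.
case: m m1 m' em => [[|[|[|[|//]]]] lt_m] [[|[|[|[|//]]]] lt_m1] [[|[|[|[|//]]]] lt_m'] //= _.
all: rewrite /rsector /sector_map /= !(mulr0, mulr1, addr0) ?eX ?eY => -[e1 e2].
all: have := congr1 ( *%R phi) e1; have := congr1 ( *%R phi) e2;
  rewrite ?mulrDr ?eX ?eY ?pX ?pY ?mulr1 ?pp => f2 f1.
all: try (by exfalso; lra).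
all: try (by left; split; [exact: val_inj|rewrite /ray_u; congr pair; lra]).
all: try (by right; split; [exact: val_inj|rewrite /ray_v; congr pair; lra]).
Qed.

Lemma rsector_uv m m1 : val m = (val m1).+1 -> rsector m1 v = rsector m u.
Proof.
by case: m m1 => [[|[|[|[|//]]]] lt_m] [[|[|[|[|//]]]] lt_m1] //= _;
   rewrite /rsector /sector_map /=; congr pair; ring.
Qed.

(** The vertex is interior to the cone of w, so a geodesic ending there belongs
    to a word that extends w.  The next letter is one of the two cones next to
    the vertex, and all further letters have to stay next to it. *)
Lemma node_edge_inner w m m1 e w' y : val m = (val m1).+1 ->
  node_edge e w' (pt (rword (rcons w m) u)) y -> e = true /\ exists j,
    (w' = rcons w m ++ nseq j ord0 /\ y = pt (rword w' v)) \/
    (w' = rcons w m1 ++ nseq j ord_max /\ y = pt (rword w' u)).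
Proof.
move=> em h; have [qu qv] := (@quadrant_u R, @quadrant_v R).
have mn : m != ord0 by apply/eqP => m0; move: em; rewrite m0.
have sE : rword (rcons w m) u = node_vec true (rcons w m) u by rewrite /node_vec -surjective_pairing.
have [g1 g2] := rsector_inner mn.
have [h1 h2] := rword_gt0 w g1 g2.
have rE : rword (rcons w m) u = rword w (rsector m u) by rewrite /rword word_map_rcons.
have [a [b [ab ea ey]]] : exists a b : R * R, [/\ (a = u /\ b = v) \/ (a = v /\ b = u),
    pt (rword (rcons w m) u) = pt (node_vec e w' a) & y = pt (node_vec e w' b)].
  by case: h => -[h3 h4]; [exists u, v|exists v, u]; split=> //; tauto.
have qa : quadrant a by case: ab => -[-> _].
case: e {h} ea ey => ea ey; last first.
  rewrite sE in ea; have [+ _] := node_pt_opposite qu qa ea.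
  by rewrite rE => /eqP; rewrite mulf_eq0 (gt_eqF h1) (gt_eqF h2).
split=> //; rewrite sE in ea; have [l l0] := node_pt_eq qu qa ea; rewrite rE => E.
have la : 0 <= l * a.1 /\ 0 <= l * a.2 by case: qa => *; split; rewrite mulr_ge0 // ltW.
(* A word not longer than w has its endpoints outside of the interior of the
   cone of w, or of the larger cone of a prefix of w. *)
have [sw|sw] := leqP (size w') (size w).
  have [] := @cone_disjoint R (take (size w') w) w' (rword (drop (size w') w) (rsector m u)) (l * a.1, l * a.2).
  - by rewrite size_takel.
  - by have [] := rword_gt0 (drop (size w') w) g1 g2.
  - by have [] := rword_gt0 (drop (size w') w) g1 g2.
  - by case: la.
  - by case: la.
  - by rewrite -E /rword -word_map_cat cat_take_drop.
  move=> _ E2; have [] := rword_gt0 (drop (size w') w) g1 g2; rewrite E2 /=.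
  by case: ab => -[-> _] /=; rewrite mulr0 ltxx.
have [w2 [ew E2]] : exists w2, w' = w ++ w2 /\ rsector m u = rword w2 (l * a.1, l * a.2).
  by case: la => *; apply: cone_prefix => //; exact: ltnW.
case: w2 ew E2 => [|m' w3] ew; first by move: sw; rewrite ew cats0 ltnn.
have qla : quadrant (l * a.1, l * a.2).
  by case: la qa => ? ? [? ? ?]; split=> //=; rewrite -mulrDr mulr_gt0.
rewrite /rword /= -/(rword w3 _) -/(rsector m' _) => E2.
have := rsector_boundary em (quadrant_rword w3 qla) E2.
case=> -[em' E3]; exists (size w3); [left|right].
  have [e3 e4] := rword_u_axis ltr01 qla (esym E3).
  split; first by rewrite ew em' -cats1 -catA /= {1}e3.
  by case: ab => -[ea' eb']; [rewrite ey eb'|move: e4; rewrite ea' /= mulr0 => -[] /eqP; rewrite eq_sym oner_eq0].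
have [e3 e4] := rword_v_axis ltr01 qla (esym E3).
split; first by rewrite ew em' -cats1 -catA /= {1}e3.
by case: ab => -[ea' eb']; [move: e4; rewrite ea' /= mulr0 => -[_] /eqP; rewrite eq_sym oner_eq0|rewrite ey eb'].
Qed.

Lemma adjacent_inner w m m1 y : val m = (val m1).+1 ->
  Defs.adjacent (pt (rword (rcons w m) u)) y <-> exists j,
    y = pt (rword (rcons w m ++ nseq j ord0) v) \/
    y = pt (rword (rcons w m1 ++ nseq j ord_max) u).
Proof.
move=> em; rewrite adjacent_node; split.
  case=> e [w' /(node_edge_inner em)[_ [j [[-> ->]|[-> ->]]]]]; exists j; tauto.
have U j : rword (nseq j ord0) u = u.
  elim: j => //= j IH; rewrite /rword /= -/(rword _ u) IH /sector_map /ray_u /=.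
  by congr pair; ring.
have V j : rword (nseq j ord_max) v = v.
  elim: j => //= j IH; rewrite /rword /= -/(rword _ v) IH /sector_map /ray_v /=.
  by congr pair; ring.
case=> j [->|->]; exists true.
  exists (rcons w m ++ nseq j ord0); left; split=> //.
  by rewrite /node_vec -!surjective_pairing !rword_cat U.
exists (rcons w m1 ++ nseq j ord_max); right; split=> //.
by rewrite /node_vec -!surjective_pairing !rword_cat V !rword_rcons (rsector_uv em).
Qed.
End Adjacency.

(** * The labels of the vertices *)
Section Sector.
Variable R : realType.
Local Notation phi := (@phi R).
Local Notation u := (ray_u R).
Local Notation v := (ray_v R).
Implicit Types (p q c d : R * R) (x y : option R) (w : seq 'I_4) (m : 'I_4) (e : bool).

Lemma chartB p q : quadrant p -> quadrant q ->
  chart p - chart q = (2 - phi) * wedge p q / ((p.1 + p.2) * (q.1 + q.2)).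
Proof.
case=> _ _ p0 [_ _ q0]; rewrite /chart /wedge; field.
by rewrite !gt_eqF.
Qed.

Lemma chart_lt p q : quadrant p -> quadrant q -> (chart q < chart p) = (0 < wedge p q).
Proof.
move=> hp hq; rewrite -subr_gt0 chartB //; case: hp hq => _ _ p0 [_ _ q0].
rewrite mulrAC pmulr_rgt0 // divr_gt0 ?mulr_gt0 //.
by have := phi_lt R; lra.
Qed.

Lemma chart_le p q : quadrant p -> quadrant q -> (chart q <= chart p) = (0 <= wedge p q).
Proof.
move=> hp hq; rewrite leNgt chart_lt //.
have -> : wedge q p = - wedge p q by rewrite /wedge; ring.
by rewrite oppr_gt0 -leNgt.
Qed.

Lemma chart_range p : quadrant p -> - (1 - phi / 2) <= chart p <= 1 - phi / 2.
Proof.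
move=> hp; have -> : 1 - phi / 2 = chart u by rewrite /chart /= subr0 addr0 divr1 mulr1.
have -> : - chart u = chart v by rewrite /chart /= !(subr0, addr0, add0r, sub0r) !divr1; ring.
rewrite !chart_le //; try exact: quadrant_u; try exact: quadrant_v.
by case: hp => p1 p2 _; rewrite /wedge /= !(mulr1, mulr0, mul1r, mul0r, subr0); apply/andP.
Qed.

(** The mirror image of the sector is the outside of the arc of the sector. *)
Lemma chart_outside p : 0 < p.1 -> 0 < p.2 -> p.1 != p.2 ->
  1 - phi / 2 < `|chart (p.1, - p.2)|.
Proof.
move=> p1 p2 ne; have a0 := chart_scale_gt0 R; rewrite /chart /= opprK normrM (gtr0_norm a0).
rewrite ltr_pMr // normrM normfV (gtr0_norm (addr_gt0 p1 p2)).
have d0 : 0 < `|p.1 - p.2| by rewrite normr_gt0 subr_eq0.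
by rewrite ltr_pdivlMr // mul1r ltr_norml; apply/andP; split; lra.
Qed.

Definition pentagon_ray (k : nat) : R * R :=
  match k with
  | 0%N => u
  | 1%N => (phi, 1)
  | 2%N => (phi, phi)
  | 3%N => (1, phi)
  | _ => v
  end.

Lemma rsector_rays m : rsector m u = pentagon_ray m /\ rsector m v = pentagon_ray m.+1.
Proof.
by case: m => [[|[|[|[|//]]]] lt_m]; rewrite /rsector /sector_map /=; split;
   congr pair; ring.
Qed.

Lemma quadrant_ray k : quadrant (pentagon_ray k).
Proof.
have pg := phi_gt R.
case: k => [|[|[|[|k]]]]; rewrite /quadrant /=; split; rewrite ?ler01 ?addr0 ?add0r ?ltr01 //; lra.
Qed.

Lemma wedge_rays k : (k < 4)%N -> wedge (pentagon_ray k) (pentagon_ray k.+1) = 1.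
Proof.
have pp := phi_sq R.
by case: k => [|[|[|[|//]]]] _; rewrite /wedge /=; lra.
Qed.

Lemma is_side_mem (p : 5.-tuple (option R)) x y : is_side p x y -> (x \in (p : seq _)) /\ (y \in (p : seq _)).
Proof. by case=> j [[-> ->]|[-> ->]]; rewrite !mem_tnth. Qed.

Lemma mem_is_side (p : 5.-tuple (option R)) x : x \in (p : seq _) -> exists y, is_side p x y.
Proof. by case/tnthP=> j ->; exists (tnth p (ordS j)), j; left. Qed.

(** The rays of [pentagon_ray] are the vertices of a pentagon in the basis of the
    side through which it was obtained. *)
Lemma represents_mem (p : 5.-tuple (option R)) w x : represents p true w ->
  x \in (p : seq _) <-> exists2 k, (k < 5)%N & x = pt (rword w (pentagon_ray k)).
Proof.
move=> rp; split.
  case/mem_is_side => y /rp/node_sideP.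
  rewrite /node_edge /node_vec -!surjective_pairing.
  case=> [[[-> _]|[-> _]]|[m]]; [by exists 0%N|by exists 4%N|].
  have [e1 e2] := rsector_rays m.
  rewrite -!surjective_pairing !rword_rcons e1 e2.
  by case=> -[-> _]; [exists m|exists m.+1] => //; have := ltn_ord m; lia.
case=> k k5 ->.
have [k4|k4] := ltnP k 4.
  have [e1 _] := rsector_rays (Ordinal k4).
  have h : node_side true w (pt (rword w (pentagon_ray k))) (pt (node_vec true (rcons w (Ordinal k4)) v)).
    apply/node_sideP; right; exists (Ordinal k4); left; split=> //.
    by rewrite /node_vec -!surjective_pairing rword_rcons e1.
  by have [] := is_side_mem ((rp _ _).2 h).
have h : node_side true w (pt (node_vec true w u)) (pt (rword w (pentagon_ray k))).
  apply/node_sideP; left; left; split=> //.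
  have -> : k = 4%N by lia.
  by rewrite /node_vec -!surjective_pairing.
by have [] := is_side_mem ((rp _ _).2 h).
Qed.

Lemma cramer c d q : wedge c d = 1 -> q = comb (wedge q d) (wedge c q) c d.
Proof.
case: q => x y; rewrite /wedge /comb /= => h; congr pair.
  by rewrite -[LHS]mulr1 -h; ring.
by rewrite -[LHS]mulr1 -h; ring.
Qed.

(** The pentagon across the arc is not given by its word but by its generation
    and by having all its vertices in the arc.  The second vertex is interior to
    the cone of the word of the pentagon, and it lies in the closed cone of w;
    hence the two words are equal. *)
Lemma sector_arc_word w (a b : R) : sector_arc w a b ->
  a = chart (rword w u) /\ b = chart (rword w v).
Proof.
elim=> [|{}w {}a {}b p vs m _ [ea eb] gp perm srt v0 v4].
  by rewrite /chart /= !(subr0, addr0, add0r, sub0r) !divr1; split; ring.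
have [nodeP _] := generation_node R (size w).+1.
have [e [w' [lw rp]]] := nodeP p gp.
have memp (x : R) : (Some x \in (p : seq _)) = (x \in (vs : seq R)).
  by rewrite (perm_mem perm) mem_map // => ? ? [].
have range (x : R) : x \in (vs : seq R) -> b <= x <= a.
  case: vs srt v0 v4 {perm memp} => -[|x0 [|x1 [|x2 [|x3 [|x4 [|//]]]]]] //= _.
  rewrite !inE => /and5P[h1 h2 h3 h4 _] e0 e4; rewrite -e0 -e4.
  by case/or4P => [/eqP->|/eqP->|/eqP->|/orP[]/eqP->]; apply/andP; split; lra.
(* An inner vertex of p, which locates the node of p. *)
pose q := rword w' (pentagon_ray 1).
have [q1 q2] : 0 < q.1 /\ 0 < q.2 by apply: rword_gt0 => /=; rewrite ?phi_gt0 ?ltr01.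
have qv : pt (q.1, if e then q.2 else - q.2) \in (p : seq _).
  have h : node_side e w' (pt (q.1, if e then q.2 else - q.2)) (pt (node_vec e (rcons w' (@Ordinal 4 1 isT)) v)).
    apply/node_sideP; right; exists (@Ordinal 4 1 isT); left; split=> //.
    by rewrite /node_vec rword_rcons (rsector_rays _).1.
  by have [] := is_side_mem ((rp _ _).2 h).
have qw : quadrant q by apply: quadrant_rword; exact: quadrant_ray.
have [qu qv0] := (@quadrant_u R, @quadrant_v R).
case: e lw rp qv => lw rp qv; last first.
  exfalso; move: qv; rewrite /pt /=; case: eqP => [_|/eqP ne].
    by rewrite (perm_mem perm) => /mapP[].
  rewrite memp => /range; rewrite ea eb => /andP[h1 h2].
  have ne' : q.1 != q.2 by rewrite -subr_eq0.
  have := chart_outside q1 q2 ne'.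
  have := chart_range (quadrant_rword w qu); have := chart_range (quadrant_rword w qv0).
  by rewrite ltNge ler_norml => /andP[? ?] /andP[? ?] /negP[]; apply/andP; split; lra.
have ww : w' = w.
  move: qv; rewrite -surjective_pairing pt_Some ?memp; last by case: qw.
  move=> /range; rewrite ea eb !chart_le //; try exact: quadrant_rword.
  move=> /andP[h1 h2].
  have det : wedge (rword w u) (rword w v) = 1.
    by rewrite wedge_rword /wedge /= !(mulr0, mulr1, subr0).
  have [] := @cone_disjoint R w' w (pentagon_ray 1) (wedge q (rword w v), wedge (rword w u) q) => //=.
  - by case: lw.
  - exact: phi_gt0.
  rewrite -[RHS]/(rword w (_, _)) -(comb_uv (wedge q (rword w v), wedge (rword w u) q)) rword_comb.
  exact: cramer.
rewrite {}ww in rp; pose L := [seq chart (rword w (pentagon_ray k)) | k <- iota 0 5].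
have qr k : quadrant (rword w (pentagon_ray k)) by apply: quadrant_rword; exact: quadrant_ray.
have step k : (k < 4)%N -> chart (rword w (pentagon_ray k.+1)) < chart (rword w (pentagon_ray k)).
  by move=> hk; rewrite chart_lt // wedge_rword wedge_rays.
have eL : (vs : seq R) = L.
  apply: (@irr_sorted_eq _ >%R); first by move=> x y z; rewrite /= => h1 h2; exact: lt_trans h2 h1.
  - by move=> x; rewrite /= ltxx.
  - exact: srt.
  - by rewrite /L /=; apply/and5P; split=> //;
      [exact: (step 0%N)|exact: (step 1%N)|exact: (step 2%N)|exact: (step 3%N)].
  move=> x; rewrite -memp; apply/idP/mapP.
    move/(represents_mem _ rp) => [k k5]; rewrite pt_Some; last by case: (qr k).
    by case=> ->; exists k; rewrite // mem_iota.
  case=> k; rewrite mem_iota => k5 ->; apply/(represents_mem _ rp).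
  by exists k => //; rewrite pt_Some //; case: (qr k).
have [e1 e2] := rsector_rays m.
rewrite eL /L !rword_rcons e1 e2 !(nth_map 0%N) ?size_iota //; try (by have := ltn_ord m; lia).
by rewrite !nth_iota //; have := ltn_ord m; lia.
Qed.
End Sector.

(** * Enumeration of the adjacent points and of their periods *)
Section Sequences.
Variable R : realType.

Lemma decreasing_le (f : nat -> R) i j : (forall i, f i.+1 < f i) -> (i <= j)%N -> f j <= f i.
Proof.
move=> df; elim: j => [|j IH]; first by rewrite leqn0 => /eqP->.
by rewrite leq_eqVlt => /orP[/eqP->//|/IH]; exact: (le_trans (ltW (df j))).
Qed.

(** The n-th term is the n-th largest value. *)
Lemma enumeration_eq (f g : nat -> R) : (forall i, f i.+1 < f i) -> (forall i, g i.+1 < g i) ->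
  (forall i, exists j, f i = g j) -> (forall j, exists i, g j = f i) -> f =1 g.
Proof.
move=> df dg fg gf n; have [m] := ubnP n; elim: m n => // m IH n hm.
have lt (h : nat -> R) i j : (forall i, h i.+1 < h i) -> (i < j)%N -> h j < h i.
  by move=> dh ij; exact: le_lt_trans (decreasing_le dh ij) (dh i).
apply/eqP; rewrite eq_le; apply/andP; split.
  have [j e] := fg n; rewrite e; apply: decreasing_le => //; rewrite leqNgt; apply/negP => jn.
  by have := lt f _ _ df jn; rewrite e (IH j) ?ltxx //; lia.
have [j e] := gf n; rewrite e; apply: decreasing_le => //; rewrite leqNgt; apply/negP => jn.
by have := lt g _ _ dg jn; rewrite e (IH j) ?ltxx //; lia.
Qed.

(** The sign of gamma i - beta tells on which side of beta a point lies; on each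
    side the distances to beta decrease, hence are determined by the set. *)
Lemma two_sided_enumeration (beta : R) (gamma : int -> R) (F G : nat -> R) :
  gamma 0 = F 0%N ->
  (forall i, exists j, gamma i = F j \/ gamma i = G j) ->
  (forall j, (exists i, F j = gamma i) /\ (exists i, G j = gamma i)) ->
  (forall j, 0 < (F j - beta) * (F 0%N - beta) /\ `|F j.+1 - beta| < `|F j - beta|) ->
  (forall j, (G j - beta) * (F 0%N - beta) < 0 /\ `|G j.+1 - beta| < `|G j - beta|) ->
  (forall i, 0 <= i -> 0 < (gamma i - beta) * (gamma 0 - beta) /\
        `|gamma (i + 1) - beta| < `|gamma i - beta|) ->
  (forall i, i < 0 -> (gamma i - beta) * (gamma 0 - beta) < 0 /\
        `|gamma (i - 1) - beta| < `|gamma i - beta|) ->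
  (forall i : nat, gamma i%:Z = F i) /\ (forall i : nat, gamma (Negz i) = G i).
Proof.
move=> e0; rewrite e0 => cov onto hF hG hp hn.
have P (i : nat) : 0 < (gamma i%:Z - beta) * (F 0%N - beta) by have [] := hp i%:Z isT.
have N (i : nat) : (gamma (Negz i) - beta) * (F 0%N - beta) < 0 by have [] := hn (Negz i) isT.
have PF i : exists j, gamma i%:Z = F j.
  have [j [e|e]] := cov i%:Z; first by exists j.
  by exfalso; have := P i; rewrite e; have [+ _] := hG j; lra.
have NG i : exists j, gamma (Negz i) = G j.
  have [j [e|e]] := cov (Negz i); last by exists j.
  by exfalso; have := N i; rewrite e; have [+ _] := hF j; lra.
have FP j : exists i : nat, F j = gamma i%:Z.
  have [[[i|i] e] _] := onto j; first by exists i.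
  by exfalso; have := N i; rewrite -e; have [+ _] := hF j; lra.
have GN j : exists i : nat, G j = gamma (Negz i).
  have [_ [[i|i] e]] := onto j; last by exists i.
  by exfalso; have := P i; rewrite -e; have [+ _] := hG j; lra.
have [f0 _] := hF 0%N.
split=> i.
  have E : `|gamma i%:Z - beta| = `|F i - beta|.
    apply: (@enumeration_eq (fun i : nat => `|gamma i%:Z - beta|) (fun i => `|F i - beta|)) => /= j.
    - by have [_] := hp j%:Z isT; rewrite -PoszD addn1.
    - by have [] := hF j.
    - by have [j' ->] := PF j; exists j'.
    - by have [j' ->] := FP j; exists j'.
  have := P i; have [+ _] := hF i; move/eqP: E; rewrite eqr_norm2 => /orP[]/eqP E; first by lra.
  by rewrite E; lra.
have E : `|gamma (Negz i) - beta| = `|G i - beta|.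
  apply: (@enumeration_eq (fun i : nat => `|gamma (Negz i) - beta|) (fun i => `|G i - beta|)) => /= j.
  - by have [_] := hn (Negz j) isT; rewrite (_ : Negz j - 1 = Negz j.+1) // !NegzE; lia.
  - by have [] := hG j.
  - by have [j' ->] := NG j; exists j'.
  - by have [j' ->] := GN j; exists j'.
have := N i; have [+ _] := hG i; move/eqP: E; rewrite eqr_norm2 => /orP[]/eqP E; first by lra.
by rewrite E; lra.
Qed.

(** All the periods are values of the linear form [roman_count], up to the factor
    2 between the two kinds, at vectors which differ by phi h; the second
    component uses phi^2 h = h + phi h. *)
Lemma arithmetic_periods kind (h : gvec) (hF hG : nat -> gvec) (b B : nat) (c C : int -> nat) :
  let value h' b' B' := (arabic_length kind b')%:Z = roman_count h' *+ 2 /\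
    (arabic_length kind B')%:Z = roman_count (gvphi h') *+ 2 in
  hF 0%N + hG 0%N = gvphi h ->
  (forall j, hF j.+1 = hF j + gvphi h) -> (forall j, hG j.+1 = hG j + gvphi h) ->
  value h b B ->
  (forall i : nat, value (hF i) (c i%:Z) (C i%:Z)) ->
  (forall i : nat, value (hG i) (c (Negz i)) (C (Negz i))) ->
  arithmetic_sequence
    (fun i : int => if i < 0 then - ((c i)%:Z, (C i)%:Z) else ((c i)%:Z, (C i)%:Z))
    (B%:Z, (b + B)%N%:Z).
Proof.
move=> value e0 eF eG vh vF vG.
have pp : roman_count (gvphi (gvphi h)) = roman_count h + roman_count (gvphi h).
  by rewrite /roman_count /=; ring.
have E (h1 h2 h3 : gvec) : h1 = h2 + h3 -> roman_count h1 = roman_count h2 + roman_count h3 /\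
    roman_count (gvphi h1) = roman_count (gvphi h2) + roman_count (gvphi h3).
  by move=> ->; rewrite gvphiD !roman_countD.
case: vh => v1 v2; rewrite /value in vF vG.
case=> [i|[|i]].
- rewrite -PoszD addn1 /=.
  have [r1 r2] := E _ _ _ (eF i); have [a1 a2] := vF i; have [a3 a4] := vF i.+1.
  congr pair => /=; move: v1 v2 a1 a2 a3 a4; rewrite /arabic_length !mulr2n; case: (kind); lia.
- have -> : Negz 0 + 1 = Posz 0 by [].
  have [r1 r2] := E _ _ _ (esym e0); have [a1 a2] := vF 0%N; have [a3 a4] := vG 0%N.
  congr pair => /=; move: v1 v2 a1 a2 a3 a4; rewrite /arabic_length !mulr2n; case: (kind); lia.
have -> : Negz i.+1 + 1 = Negz i by rewrite !NegzE; lia.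
have [r1 r2] := E _ _ _ (eG i); have [a1 a2] := vG i; have [a3 a4] := vG i.+1.
congr pair => /=; move: v1 v2 a1 a2 a3 a4; rewrite /arabic_length !mulr2n; case: (kind); lia.
Qed.
End Sequences.
(** * Conclusion *)
Section Final.
Variable R : realType.
Local Notation phi := (@phi R).
Local Notation u := (ray_u R).
Local Notation v := (ray_v R).

Lemma gword_cat w1 w2 h : gword (w1 ++ w2) h = gword w1 (gword w2 h).
Proof. exact: word_map_cat. Qed.

Lemma gword_nonneg w (h : gvec) : 0 <= h.1.1 -> 0 <= h.1.2 -> 0 <= h.2.1 -> 0 <= h.2.2 ->
  let k := gword w h in [/\ 0 <= k.1.1, 0 <= k.1.2, 0 <= k.2.1 & 0 <= k.2.2].
Proof.
move=> h1 h2 h3 h4; elim: w => //= m w []; rewrite /gword /= -/(gword w h).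
move: (gword w h) => [[a b] [c d]] /= *.
by case: m => [[|[|[|[|//]]]] lt_m]; rewrite /sector_map /=; split; lia.
Qed.

Lemma period_pair_word kind w (h : gvec) (b B : nat) : h = gu \/ h = gv ->
  period_pair kind (chart (gvval R (gword w h))) b B ->
  (arabic_length kind b)%:Z = roman_count (gword w h) *+ 2 /\
  (arabic_length kind B)%:Z = roman_count (gvphi (gword w h)) *+ 2.
Proof.
move=> hh; have [qu qv] := (@quadrant_u R, @quadrant_v R).
have [q prim tt [n1 n2 n3 n4]] : [/\ quadrant (gvval R h), indivisible h,
    two_towers (gvval R h) h (gvphi h) &
    let k := gword w h in [/\ 0 <= k.1.1, 0 <= k.1.2, 0 <= k.2.1 & 0 <= k.2.2]].
  case: hh => ->; [rewrite gvval_gu|rewrite gvval_gv]; split=> //; try exact: gword_nonneg.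
  - exact: indivisible_gu.
  - exact: two_towers_u.
  - exact: indivisible_gv.
  - exact: two_towers_v.
rewrite gvval_word; have [k1 k2 k0] := quadrant_rword w q.
apply: (period_pair_two_towers k1 k2 k0).
- by case: q => q1 q2 _; exact: two_towers_word.
- exact: indivisible_word.
- by rewrite /roman_count /=; lia.
Qed.

(** The letter 0 repeated keeps u and adds phi u to v each time. *)
Lemma gword_nseq_ord0 m w j : gword (rcons w m ++ nseq j.+1 ord0) gv =
  gword (rcons w m ++ nseq j ord0) gv + gvphi (gword (rcons w m) gu).
Proof.
have U i : gword (nseq i ord0) gu = gu by elim: i => //= i IH; rewrite IH.
have -> : nseq j.+1 ord0 = nseq j ord0 ++ [:: @ord0 3] by rewrite -(nseqD j 1) addn1.
rewrite catA gword_cat [gword [:: _] gv](_ : _ = gv + gvphi gu) // gwordD gword_gvphi.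
by rewrite [in gword (_ ++ _) gu]gword_cat U.
Qed.

Lemma gword_nseq_max m w j : gword (rcons w m ++ nseq j.+1 ord_max) gu =
  gword (rcons w m ++ nseq j ord_max) gu + gvphi (gword (rcons w m) gv).
Proof.
have U i : gword (nseq i ord_max) gv = gv by elim: i => //= i IH; rewrite IH.
have -> : nseq j.+1 ord_max = nseq j ord_max ++ [:: @ord_max 3] by rewrite -(nseqD j 1) addn1.
rewrite catA gword_cat [gword [:: _] gu](_ : _ = gu + gvphi gv) // gwordD gword_gvphi.
by rewrite [in gword (_ ++ _) gv]gword_cat U.
Qed.

Lemma gsector_uv (m m1 : 'I_4) : val m = (val m1).+1 ->
  sector_map gphi m1 gv = sector_map gphi m gu /\
  sector_map gphi m gv + sector_map gphi m1 gu = gvphi (sector_map gphi m gu).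
Proof.
by case: m m1 => [[|[|[|[|//]]]] lt_m] [[|[|[|[|//]]]] lt_m1] //= _;
   split; apply: gvecP.
Qed.

Lemma gword_rcons w m h : gword (rcons w m) h = gword w (sector_map gphi m h).
Proof. exact: word_map_rcons. Qed.

(** Adding phi s does not change the cross product with s, so that by [chartB]
    the distance to s decreases while the coordinates grow. *)
Lemma neighbours_approach (s : gvec) (F : nat -> gvec) : quadrant (gvval R s) ->
  (forall j, quadrant (gvval R (F j))) -> wedge (gvval R (F 0%N)) (gvval R s) != 0 ->
  (forall j, F j.+1 = F j + gvphi s) ->
  forall j, 0 < (chart (gvval R (F j)) - chart (gvval R s)) * wedge (gvval R (F 0%N)) (gvval R s) /\
    `|chart (gvval R (F j.+1)) - chart (gvval R s)| < `|chart (gvval R (F j)) - chart (gvval R s)|.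
Proof.
move=> qs qF w0 FS.
have W j : wedge (gvval R (F j)) (gvval R s) = wedge (gvval R (F 0%N)) (gvval R s).
  elim: j => // j <-; rewrite FS /wedge /gvval /= !gvalD !gval_phi; ring.
have pl : 0 < 2 - phi by have := phi_lt R; lra.
move=> j; rewrite !chartB // !W; move: (wedge _ _) w0 => t t0.
have [s1 s2 s0] := qs; have [_ _ f0] := qF j; have [_ _ f1] := qF j.+1.
split.
  have t2 : 0 < t * t by rewrite -expr2 exprn_even_gt0.
  rewrite [(2 - phi) * t / _]mulrAC -[_ * t * t]mulrA; apply: mulr_gt0 => //.
  by rewrite divr_gt0 ?mulr_gt0.
rewrite !normrM ltr_pM2l; last by rewrite mulr_gt0 ?normr_gt0 // gt_eqF.
rewrite !ger0_norm ?invr_ge0 ?mulr_ge0 ?(ltW f0) ?(ltW f1) ?(ltW s0) //.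
rewrite ltf_pV2 ?posrE ?mulr_gt0 // ltr_pM2r //.
rewrite FS /gvval /= !gvalD !gval_phi.
have : 0 < phi * (gval R s.1 + gval R s.2) by rewrite mulr_gt0 // phi_gt0.
by rewrite mulrDr; lra.
Qed.

(** Among the words of [node_edge_inner] only the shortest ones belong to the
    generation in which the vertex appears. *)
Lemma first_neighbours w (m m1 : 'I_4) (p : 5.-tuple (option R)) y : val m = (val m1).+1 ->
  generation (size w).+1 p -> is_side p (pt (rword (rcons w m) u)) y ->
  y = pt (rword (rcons w m) v) \/ y = pt (rword (rcons w m1) u).
Proof.
move=> em gp sp; have [/(_ p gp) [e [w' [lw rp]]] _] := generation_node R (size w).+1.
move/rp/node_sideP: sp => [h|[m' h]].
  have [ee [j hw]] := node_edge_inner em h; exfalso; move: lw; rewrite ee /node_level.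
  by case: hw => -[-> _]; rewrite size_cat size_rcons size_nseq; lia.
have [ee [j hw]] := node_edge_inner em h; move: lw; rewrite ee /node_level => lw.
have j0 : j = 0%N.
  have : size (rcons w' m') = (size w).+1 by rewrite size_rcons.
  by case: hw => -[-> _]; rewrite size_cat size_rcons size_nseq; lia.
by case: hw => -[ew ey]; rewrite ey ew j0 cats0; [left|right].
Qed.

End Final.

Unset Implicit Arguments.

Theorem theorem3 (R : realType) (kind : period_kind)
    (k : nat) (n : k.-tuple 'I_4) (beta : R) (gamma : int -> R)
    (b B : nat) (c C : int -> nat) :
  (1 <= k)%N ->
  last ord0 n != ord0 ->
  is_alpha n beta ->
  neighbour_sequence k beta gamma ->
  period_pair kind beta b B ->
  (forall i : int, period_pair kind (gamma i) (c i) (C i)) ->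
  arithmetic_sequence
    (fun i : int => if i < 0 then - ((c i)%:Z, (C i)%:Z) else ((c i)%:Z, (C i)%:Z))
    (B%:Z, (b + B)%N%:Z).
Proof.
move=> k1 ln [b0 /sector_arc_word[ebeta _]] [adj [p [j [gp pj nb]]] pos neg] vb vc.
have sn := size_tuple n.
case/lastP: (tval n) sn ln ebeta => [|w m]; first by move=> k0; rewrite -k0 in k1.
rewrite size_rcons last_rcons => sw mn ebeta.
have m1lt : ((val m).-1 < 4)%N by apply: leq_ltn_trans (leq_pred _) (ltn_ord m).
pose m1 := Ordinal m1lt.
have em : val m = (val m1).+1 by rewrite /= prednK // lt0n; exact: mn.
have [qu qv] := (@quadrant_u R, @quadrant_v R).
pose hs := gword (rcons w m) gu.
(* Short vectors of the points adjacent to beta, below and above it, in order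
   of approach. *)
pose hbelow i := gword (rcons w m ++ nseq i ord0) gv.
pose habove i := gword (rcons w m1 ++ nseq i ord_max) gu.
have [euv esum] := gsector_uv em.
have gs : gvval R hs = rword (rcons w m) (ray_u R) by rewrite gvval_word gvval_gu.
have gbelow i : gvval R (hbelow i) = rword (rcons w m ++ nseq i ord0) (ray_v R) by rewrite gvval_word gvval_gv.
have gabove i : gvval R (habove i) = rword (rcons w m1 ++ nseq i ord_max) (ray_u R) by rewrite gvval_word gvval_gu.
have qs : quadrant (gvval R hs) by rewrite gs; exact: quadrant_rword.
have qbelow i : quadrant (gvval R (hbelow i)) by rewrite gbelow; exact: quadrant_rword.
have qabove i : quadrant (gvval R (habove i)) by rewrite gabove; exact: quadrant_rword.
have ptq (q : R * R) : quadrant q -> pt q = Some (chart q) by case=> _ _; exact: pt_Some.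
have eb : beta = chart (gvval R hs) by rewrite gs.
have pb : Some beta = pt (rword (rcons w m) (ray_u R)) by rewrite -gs ptq // eb.
have hs' : hs = gword (rcons w m1) gv by rewrite /hs !gword_rcons euv.
have belowS i : hbelow i.+1 = hbelow i + gvphi hs by exact: gword_nseq_ord0.
have aboveS i : habove i.+1 = habove i + gvphi hs by rewrite hs'; exact: gword_nseq_max.
have e0 : hbelow 0%N + habove 0%N = gvphi hs.
  by rewrite /hbelow /habove /hs !cats0 !gword_rcons -gwordD esum gword_gvphi.
have adjE y : (exists i, y = gamma i) <->
    exists i, y = chart (gvval R (hbelow i)) \/ y = chart (gvval R (habove i)).
  transitivity (Defs.adjacent (Some beta) (Some y)).
    by rewrite adj; split=> -[i e]; exists i; [rewrite e|case: e].
  rewrite pb (adjacent_inner _ _ em); split=> -[i h]; exists i.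
    by move: h; rewrite -gbelow -gabove !ptq // => -[[]|[]]; tauto.
  by move: h; rewrite -gbelow -gabove !ptq // => -[] ->; tauto.
have wbelow : wedge (gvval R (hbelow 0%N)) (gvval R hs) = -1.
  by rewrite gbelow gs cats0 wedge_rword /wedge /= !(mulr0, mulr1) sub0r.
have wabove : wedge (gvval R (habove 0%N)) (gvval R hs) = 1.
  rewrite gabove hs' gvval_word gvval_gv cats0 wedge_rword /wedge /= !(mulr0, mulr1).
  by rewrite subr0.
have abelow := @neighbours_approach R hs hbelow qs qbelow; rewrite wbelow oppr_eq0 oner_eq0 in abelow.
have aabove := @neighbours_approach R hs habove qs qabove; rewrite wabove oner_eq0 in aabove.
have {}abelow := abelow isT belowS; have {}aabove := aabove isT aboveS.
rewrite -eb in abelow aabove.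
have side_next : is_side p (tnth p j) (tnth p (ordS j)) by exists j; left.
have side_prev : is_side p (tnth p j) (tnth p (ord_pred j)).
  by exists (ord_pred j); right; rewrite ord_predK.
have first i : i = 0 \/ i = -1 -> gamma i = chart (gvval R (hbelow 0%N)) \/ gamma i = chart (gvval R (habove 0%N)).
  move=> hi; have sd : is_side p (pt (rword (rcons w m) (ray_u R))) (Some (gamma i)).
    by rewrite -pb -pj; case: nb => -[n1 n2]; case: hi => ->; rewrite ?n1 ?n2.
  rewrite -sw in gp; have := first_neighbours em gp sd.
  have := gbelow 0%N; have := gabove 0%N; rewrite !cats0 => <- <-; rewrite !ptq //.
  by case=> -[->]; [left|right].
have vs : (arabic_length kind b)%:Z = roman_count hs *+ 2 /\
    (arabic_length kind B)%:Z = roman_count (gvphi hs) *+ 2.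
  by apply: (@period_pair_word R); [left|rewrite -/hs -eb].
have vbelow i l : gamma i = chart (gvval R (hbelow l)) -> (arabic_length kind (c i))%:Z = roman_count (hbelow l) *+ 2 /\
    (arabic_length kind (C i))%:Z = roman_count (gvphi (hbelow l)) *+ 2.
  by move=> e; apply: (@period_pair_word R); [right|rewrite -/(hbelow l) -e].
have vabove i l : gamma i = chart (gvval R (habove l)) -> (arabic_length kind (c i))%:Z = roman_count (habove l) *+ 2 /\
    (arabic_length kind (C i))%:Z = roman_count (gvphi (habove l)) *+ 2.
  by move=> e; apply: (@period_pair_word R); [left|rewrite -/(habove l) -e].
have below0 := abelow 0%N; have above0 := aabove 0%N.
have onto l : (exists i, chart (gvval R (hbelow l)) = gamma i) /\ (exists i, chart (gvval R (habove l)) = gamma i).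
  by split; apply/adjE; exists l; tauto.
have cov i : exists l, gamma i = chart (gvval R (hbelow l)) \/ gamma i = chart (gvval R (habove l)).
  by apply/adjE; exists i.
(* gamma 0 may be on either side of beta; the other side is that of gamma (-1). *)
case: (first 0); first by left.
- move=> g0.
  have [gP gN] : (forall i : nat, gamma i%:Z = chart (gvval R (hbelow i))) /\
      (forall i : nat, gamma (Negz i) = chart (gvval R (habove i))).
    apply: (two_sided_enumeration g0 cov onto _ _ pos neg) => l.
      by have [h1 h2] := abelow l; split=> //; move: below0 h1 => [] *; nra.
    by have [h1 h2] := aabove l; split=> //; move: below0 h1 => [] *; nra.
  apply: (@arithmetic_periods kind hs hbelow habove) => // i; [exact: vbelow|exact: vabove].
move=> g0.
have [gP gN] : (forall i : nat, gamma i%:Z = chart (gvval R (habove i))) /\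
    (forall i : nat, gamma (Negz i) = chart (gvval R (hbelow i))).
  apply: (two_sided_enumeration g0 _ _ _ _ pos neg) => l.
  - by have [i h] := cov l; exists i; tauto.
  - by have [h1 h2] := onto l.
  - by have [h1 h2] := aabove l; split=> //; move: above0 h1 => [] *; nra.
  by have [h1 h2] := abelow l; split=> //; move: above0 h1 => [] *; nra.
apply: (@arithmetic_periods kind hs habove hbelow) => //; first by rewrite addrC.
  by move=> i; exact: vabove.
by move=> i; exact: vbelow.
Qed.
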